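(* Let $\mathcal A=\{r_0,\dots,r_m\}\subset\mathbb Z^n$ with $\mathbb Z\mathcal A=\mathbb Z^n$ and fix $k\in\mathbb N$. A point $u\in\mathbb R^{m+1}$ lies in the tropicalization $\operatorname{trop}(Y^{(k)}_{\mathcal A})$ of the affine cone over the $k$-th dual variety of $X_{\mathcal A}$ if and only if \[\bigcap_{Q\in\mathbb Q[y_1,\dots,y_n],\ \deg(Q)\le k}V\!\left(\frac{\partial p_{\mathcal A,u}}{\partial Q}\right)\ne\emptyset.\] Moreover, this intersection is given by a finite number of Euler derivatives of $p_{\mathcal A,u}$.
   Context: $X_{\mathcal A}\subset\mathbb P^m$ is the closure of the image of $x\mapsto(x^{r_0}:\dots:x^{r_m})$; $X^{(k)}_{\mathcal A}\subset(\mathbb P^m)^\vee$ is the closure of the set of hyperplanes containing the $k$-th osculating space at some smooth point of $X_{\mathcal A}$; $Y^{(k)}_{\mathcal A}\subset\mathbb C^{m+1}$ its affine cone. For $Y\subset\mathbb C^{m+1}$ with ideal $I$ defined over $\mathbb Q$, $\operatorname{trop}(Y)=\{w:\operatorname{in}_w(F)\text{ is not a monomial for all }0\ne F\in I\}$, with $\operatorname{in}_w(F)$ the sum of terms $F_\alpha x^\alpha$ minimizing $\langle\alpha,w\rangle$. For $u\in\mathbb R^{m+1}$, the tropical polynomial $p_{\mathcal A,u}\colon\mathbb R^n\to\mathbb R$ is $p_{\mathcal A,u}(w)=\min_{i=0,\dots,m}(u_i+\langle w,r_i\rangle)$. For a polynomial $Q$, the Euler derivative $\frac{\partial p_{\mathcal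 A,u}}{\partial Q}$ is the tropical polynomial $\min\{u_i+\langle w,r_i\rangle: Q(r_i)\ne0\}$ (the subsum of terms of $p_{\mathcal A,u}$ for points $r_i$ where $Q$ does not vanish). For a tropical polynomial $p$, $V(p)\subset\mathbb R^n$ is the set of $w$ where the minimum is attained by at least two terms (with the convention that the tropical polynomial with no terms vanishes on all of $\mathbb R^n$).
   Formalization: The k-th dual variety is taken as the closure of hyperplanes osculating at torus points of X_A, not at all smooth points; for k ≥ 2 the latter can add components and the claim fails, e.g. A={(0..3,0),(0..2,1),(0,3)}, k=2, u=0. *)

(* Defs.v *)
From mathcomp Require Import all_boot all_order all_algebra.
From mathcomp Require Import Rstruct.
From mathcomp Require Export complex.
From mathcomp Require Export mpoly.
Set Implicit Arguments. Unset Strict Implicit. Unset Printing Implicit Defensive.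
Import GRing.Theory Num.Theory.
Local Open Scope ring_scope.

Notation RR := Rdefinitions.R.
Notation CC := (complex Rdefinitions.R).

Definition lattice_spans (n m : nat) (r : 'I_m.+1 -> 'I_n -> int) : Prop :=
  forall v : 'I_n -> int, exists a : 'I_m.+1 -> int,
    forall j : 'I_n, v j = \sum_(i < m.+1) a i * r i j.

Definition ffz (a : int) (t : nat) : int := \prod_(l < t) (a - l%:Z).

(* the partial derivative d^alpha of the Laurent monomial y^rho,
   evaluated at the torus point x:
   d^alpha y^rho = (prod_j rho_j (rho_j - 1) ... (rho_j - alpha_j + 1)) y^(rho - alpha) *)
Definition dmon (n : nat) (rho : 'I_n -> int) (alpha : 'I_n -> nat)
    (x : 'I_n -> CC) : CC :=
  (\prod_(j < n) ffz (rho j) (alpha j))%:~R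
    * \prod_(j < n) (x j) ^ (rho j - (alpha j)%:Z).

Definition torus_pt (n : nat) (x : 'I_n -> CC) : Prop := forall j, x j != 0.

(* The linear form c = (c_0 : ... : c_m) vanishes on the k-th osculating
   space of X_A at the point phi(x), phi(x) = (x^r_0 : ... : x^r_m), i.e.
   on all partial derivatives of order <= k of the parametrisation phi at x. *)
Definition osc_hyperplane (n m : nat) (r : 'I_m.+1 -> 'I_n -> int) (k : nat)
    (x : 'I_n -> CC) (c : 'I_m.+1 -> CC) : Prop :=
  forall alpha : 'I_n -> nat, (\sum_(j < n) alpha j <= k)%N ->
    \sum_(i < m.+1) c i * dmon (r i) alpha x = 0.

(* Points of the affine cone over the set of hyperplanes containing the k-th
   osculating space at some (smooth) torus point of X_A; the origin is
   included.  Y^(k)_A is the Zariski closure of this set. *)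
Definition dual_cone_pt (n m : nat) (r : 'I_m.+1 -> 'I_n -> int) (k : nat)
    (c : 'I_m.+1 -> CC) : Prop :=
  exists x : 'I_n -> CC, torus_pt x /\ osc_hyperplane r k x c.

(* The ideal I of Y^(k)_A in C[c_0,...,c_m]: the polynomials vanishing on
   Y^(k)_A, equivalently on the dense set dual_cone_pt. *)
Definition ideal_Yk (n m : nat) (r : 'I_m.+1 -> 'I_n -> int) (k : nat)
    (F : {mpoly CC[m.+1]}) : Prop :=
  forall c : 'I_m.+1 -> CC, dual_cone_pt r k c -> F.@[c] = 0.

Definition mweight (N : nat) (w : 'I_N -> RR) (a : 'X_{1..N}) : RR :=
  \sum_(i < N) (a i)%:R * w i.

Definition initial_form (N : nat) (w : 'I_N -> RR) (F : {mpoly CC[N]})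
    : {mpoly CC[N]} :=
  \sum_(a <- msupp F | all (fun b => mweight w a <= mweight w b) (msupp F))
     F@_a *: 'X_[a].

Definition is_monomial (N : nat) (P : {mpoly CC[N]}) : Prop :=
  exists (c : CC) (a : 'X_{1..N}), c != 0 /\ P = c *: 'X_[a].

Definition trop_Yk (n m : nat) (r : 'I_m.+1 -> 'I_n -> int) (k : nat)
    (u : 'I_m.+1 -> RR) : Prop :=
  forall F : {mpoly CC[m.+1]}, F != 0 -> ideal_Yk r k F ->
    ~ is_monomial (initial_form u F).

Definition trop_term (n m : nat) (r : 'I_m.+1 -> 'I_n -> int)
    (u : 'I_m.+1 -> RR) (w : 'I_n -> RR) (i : 'I_m.+1) : RR :=
  u i + \sum_(j < n) w j * (r i j)%:~R.

Definition evalQ (n : nat) (Q : {mpoly rat[n]}) (rho : 'I_n -> int) : rat :=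
  Q.@[fun j => (rho j)%:~R].

(* w in V(dp_{A,u}/dQ): the Euler derivative is the tropical polynomial
   min {u_i + <w, r_i> : Q(r_i) <> 0}; w lies in its tropical hypersurface
   iff the minimum is attained by at least two terms, with the convention
   that the empty tropical polynomial vanishes everywhere. *)
Definition in_V_euler (n m : nat) (r : 'I_m.+1 -> 'I_n -> int)
    (u : 'I_m.+1 -> RR) (Q : {mpoly rat[n]}) (w : 'I_n -> RR) : Prop :=
  (forall i, evalQ Q (r i) = 0) \/
  exists i j : 'I_m.+1, [/\ i != j, evalQ Q (r i) != 0, evalQ Q (r j) != 0,
    trop_term r u w i = trop_term r u w j &
    forall l, evalQ Q (r l) != 0 -> trop_term r u w i <= trop_term r u w l].

(* deg Q <= k  (msize Q = 1 + total degree, msize 0 = 0) *)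
Definition deg_le (n : nat) (Q : {mpoly rat[n]}) (k : nat) : bool :=
  (msize Q <= k.+1)%N.

(* Main.v *)
Require Import Defs.
From mathcomp Require Import all_boot all_order all_algebra.
From mathcomp Require Import Rstruct complex mpoly boolp.
From mathcomp Require Import fraction ring lra zify.
From Stdlib Require Rpower Exp_prop.
Import Order.TTheory GRing.Theory Num.Theory.
Set Implicit Arguments. Unset Strict Implicit. Unset Printing Implicit Defensive.
Local Open Scope ring_scope.

(* Write c_i x^{r_i} = d_i. A point c lies in the cone over the torus point x iff
   d lies in the rational linear space L cut out by the relations
   sum_i Q(r_i) d_i = 0, deg Q <= k; tropically, trop_term r u w is the valuation
   of d when u and w are those of c and x.

   If w is in all the V(dp/dQ), linear duality gives for each i a rational vector
   of L with nonzero i-th entry, supported where trop_term is at most its i-th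
   value. A generic combination, scaled by powers t^{trop_term}, is a curve in
   the cone along which a polynomial with monomial initial form does not vanish
   as t -> 0.

   Conversely let c be the generic point of the cone. That no relation between
   the c_i has a monomial initial form says that the Laurent monomials in c of
   positive u-weight generate a proper ideal in the ring spanned by those of
   nonnegative weight. Chevalley's extension argument, applied to the finitely
   many quotients d_j / d_i only, yields a total preorder on the d_i for which
   the minimum is attained twice in every linear relation. By Farkas' lemma this
   preorder is compatible with some real w: an integral certificate of
   infeasibility would be a Laurent monomial in c alone of the wrong weight. *)

(** * Farkas' lemma with integral multipliers *)

(** Either list may be empty. This solves the bounds on a single variable that Fourier-Motzkin
    elimination leaves. *)
Lemma between_seqs (R : realFieldType) (L U : seq R) :
  (forall l x, l \in L -> x \in U -> l <= x) ->
  exists t, (forall l, l \in L -> l <= t) /\ (forall x, x \in U -> t <= x).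
Proof.
elim: L => [_|l L IH LU].
  elim: U => [|x U [t [_ tU]]]; first by exists 0.
  exists (Num.min x t); split=> // y; rewrite inE => /predU1P[->|yU].
    by rewrite ge_min lexx.
  by rewrite ge_min (tU _ yU) orbT.
have [|t [Lt tU]] := IH.
  by move=> l' x l'L; apply: LU; rewrite inE l'L orbT.
exists (Num.max l t); split=> [l'|x xU].
  by rewrite inE => /predU1P[->|/Lt l't]; rewrite le_max ?lexx ?l't ?orbT.
by rewrite ge_max tU // LU ?inE ?eqxx.
Qed.

(* Fourier-Motzkin elimination of the first coordinate.  [P] stands for the set
   of the consequences of the system [S]. *)
Lemma integral_farkas (R : realFieldType) (n : nat)
    (P : 'rV[int]_n -> R -> Prop) (S : seq ('rV[int]_n * R)) :
  (forall a b a' b', P a b -> P a' b' -> P (a + a') (b + b')) ->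
  (forall s, s \in S -> P s.1 s.2) ->
  (forall b, P 0 b -> 0 <= b) ->
  exists w : 'I_n -> R,
    forall s, s \in S -> 0 <= s.2 + \sum_j w j * (s.1 0 j)%:~R.
Proof.
elim: n P S => [|n IH] P S PD PS P0.
  exists (fun _ => 0) => s sS; rewrite big_ord0 addr0; apply: P0.
  by have := PS _ sS; rewrite (thinmx0 s.1).
(* Additivity yields positive multiples only, whence [k.+1] here and the predecessors below; the
   multipliers in [comb] are positive since the leading entries are nonzero. *)
have PM a b k : P a b -> P (a *+ k.+1) (b *+ k.+1).
  move=> Pab; elim: k => [//|k Pk]; rewrite mulrS (mulrS b); exact: PD.
pose tl (a : 'rV[int]_n.+1) : 'rV[int]_n := @rsubmx _ 1 1 n a.
have tlE a j : tl a 0 j = a 0 (lift ord0 j).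
  by rewrite mxE; congr (a _ _); apply: val_inj.
have headE (a : 'rV[int]_n.+1) : a 0 0 = 0 -> a = @row_mx _ 1 1 n 0 (tl a).
  move=> a0; rewrite -[LHS](@hsubmxK _ 1 1 n); suff -> : @lsubmx _ 1 1 n a = 0 by [].
  apply/rowP=> i; rewrite !mxE -[RHS]a0; congr (a _ _).
  by apply: val_inj; rewrite (ord1 i).
(* For leading entries of opposite signs, their absolute values used crosswise cancel the first
   coordinate with natural multipliers. *)
pose comb (p q : 'rV[int]_n.+1 * R) : 'rV[int]_n.+1 * R :=
  (p.1 *+ absz (q.1 0 0) + q.1 *+ absz (p.1 0 0),
   p.2 *+ absz (q.1 0 0) + q.2 *+ absz (p.1 0 0)).
pose pos := [seq s : 'rV[int]_n.+1 * R <- S | 0 < s.1 0 0].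
pose neg := [seq s : 'rV[int]_n.+1 * R <- S | s.1 0 0 < 0].
pose zer := [seq s : 'rV[int]_n.+1 * R <- S | s.1 0 0 == 0].
pose S0 := zer ++ [seq comb p q | p <- pos, q <- neg].
have S0P s : s \in S0 -> s.1 0 0 = 0 /\ P s.1 s.2.
  rewrite mem_cat => /orP[|/allpairsP[[p q] /=]].
    by rewrite mem_filter => /andP[/eqP-> /PS].
  rewrite !mem_filter => -[/andP[p0 pS] /andP[q0 qS] ->] /=; split.
    have pE : (absz (p.1 0 0))%:Z = p.1 0 0 by rewrite gtz0_abs.
    have qE : (absz (q.1 0 0))%:Z = - q.1 0 0 by rewrite ltz0_abs.
    by rewrite mxE !mulmxnE -(mulr_natr (p.1 0 0)) -(mulr_natr (q.1 0 0)) !natz pE qE; ring.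
  have := PM _ _ (absz (q.1 0 0)).-1 (PS _ pS).
  have := PM _ _ (absz (p.1 0 0)).-1 (PS _ qS).
  have p1 : (0 < absz (p.1 0 0)%R)%N by rewrite absz_gt0 gt_eqF.
  have q1 : (0 < absz (q.1 0 0)%R)%N by rewrite absz_gt0 lt_eqF.
  rewrite !prednK // => Pq Pp; exact: PD.
have [|||w wS] := IH (fun a b => P (@row_mx _ 1 1 n 0 a) b)
    [seq (tl s.1, s.2) | s <- S0].
- by move=> a b a' b' Pa Pa'; rewrite -[0]addr0 -add_row_mx; apply: PD.
- by move=> _ /mapP[s /S0P[s0 Ps] ->] /=; rewrite -headE.
- by move=> b; rewrite row_mx0; apply: P0.
pose ev (s : 'rV[int]_n.+1 * R) := s.2 + \sum_j w j * (s.1 0 (lift ord0 j))%:~R.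
have wS0 s : s \in S0 -> 0 <= ev s.
  move=> sS; have /= := wS _ (map_f _ sS).
  by under eq_bigr do rewrite tlE.
have ev_comb p q : ev (comb p q) = ev p *+ absz (q.1 0 0) + ev q *+ absz (p.1 0 0).
  rewrite /ev /= !mulrnDl -!sumrMnl addrACA -big_split /=; congr (_ + _).
  by apply: eq_bigr => j _; rewrite mxE !mulmxnE rmorphD !rmorphMn /=; ring.
(* A positive leading entry bounds the first coordinate [t] from below, a negative one from above.
   The bounds are compatible because [w] satisfies the inequality of each [comb p q]. *)
have [l x lp xn|t [tp tn]] := @between_seqs R
  [seq - ev p / (p.1 0 0)%:~R | p <- pos] [seq - ev q / (q.1 0 0)%:~R | q <- neg].
  case/mapP: lp => p pp ->; case/mapP: xn => q qn ->.
  have : 0 <= ev (comb p q).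
    apply: wS0; rewrite mem_cat; apply/orP; right; exact: allpairs_f.
  move: pp qn; rewrite !mem_filter ev_comb => /andP[p0 _] /andP[q0 _].
  have pE : (absz (p.1 0 0))%:R = (p.1 0 0)%:~R :> R by rewrite pmulrn gtz0_abs.
  have qE : (absz (q.1 0 0))%:R = - (q.1 0 0)%:~R :> R.
    by rewrite pmulrn ltz0_abs // rmorphN.
  rewrite -(mulr_natr (ev p)) -(mulr_natr (ev q)) pE qE.
  have pR : 0 < (p.1 0 0)%:~R :> R by rewrite ltr0z.
  have qR : (q.1 0 0)%:~R < 0 :> R by rewrite ltrz0.
  move=> h; rewrite ler_pdivrMr // mulrAC ler_ndivlMr //; lra.
exists (fun j => if unlift ord0 j is Some j' then w j' else t) => s sS.
rewrite big_ord_recl unlift_none.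
under eq_bigr do rewrite liftK.
rewrite addrCA -/(ev s).
have [s0|s0|s0] := ltgtP (s.1 0 0) 0.
- have /tn : - ev s / (s.1 0 0)%:~R \in [seq - ev q / (q.1 0 0)%:~R | q <- neg].
    by apply: map_f; rewrite mem_filter s0.
  have sR : (s.1 0 0)%:~R < 0 :> R by rewrite ltrz0.
  rewrite ler_ndivlMr //; lra.
- have /tp : - ev s / (s.1 0 0)%:~R \in [seq - ev q / (q.1 0 0)%:~R | q <- pos].
    by apply: map_f; rewrite mem_filter s0.
  have sR : 0 < (s.1 0 0)%:~R :> R by rewrite ltr0z.
  rewrite ler_pdivrMr //; lra.
- rewrite s0 mulr0 add0r; apply: wS0.
  by rewrite mem_cat mem_filter s0 eqxx sS.
Qed.

(** * Chevalley's extension argument *)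

(** [A] is a subring of [K] and [I] a proper ideal of [A]. Both are predicates on one fixed field,
    so that enlarging them changes no type. *)
Record proper_pair (K : fieldType) (A I : K -> Prop) : Prop := ProperPair {
  proper_one : A 1;
  proper_sub : forall x y, A x -> A y -> A (x - y);
  proper_mul : forall x y, A x -> A y -> A (x * y);
  proper_ideal_add : forall x y, I x -> I y -> I (x + y);
  proper_ideal_mul : forall x y, A x -> I y -> I (x * y);
  proper_ideal0 : I 0;
  proper_incl : forall x, I x -> A x;
  proper_proper : ~ I 1 }.

Lemma proper_zero (K : fieldType) (A I : K -> Prop) : proper_pair A I -> A 0.
Proof. by case=> A1 AB _ _ _ _ _ _; rewrite -(subrr 1); apply: AB. Qed.

Lemma proper_opp (K : fieldType) (A I : K -> Prop) : proper_pair A I ->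
  forall x, A x -> A (- x).
Proof.
move=> AI x Ax; rewrite -sub0r; apply: (proper_sub AI) => //; exact: proper_zero AI.
Qed.

Lemma proper_add (K : fieldType) (A I : K -> Prop) : proper_pair A I ->
  forall x y, A x -> A y -> A (x + y).
Proof.
by move=> AI x y Ax Ay; rewrite -[y]opprK; apply: (proper_sub AI) => //; apply: (proper_opp AI).
Qed.

Lemma proper_sum (K : fieldType) (A I : K -> Prop) : proper_pair A I ->
  forall (T : Type) (s : seq T) (p : pred T) (f : T -> K),
  (forall t, p t -> A (f t)) -> A (\sum_(t <- s | p t) f t).
Proof.
move=> AI T s p f Af; apply: (big_ind A) => //; first exact: proper_zero AI.
exact: proper_add AI.
Qed.

Lemma proper_ideal_sum (K : fieldType) (A I : K -> Prop) : proper_pair A I ->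
  forall (T : Type) (s : seq T) (p : pred T) (f : T -> K),
  (forall t, p t -> I (f t)) -> I (\sum_(t <- s | p t) f t).
Proof.
move=> AI T s p f Af; apply: (big_ind I) => //; first exact: proper_ideal0 AI.
exact: proper_ideal_add AI.
Qed.

(** For [P := A] this is the ring A[x]; for [P := I] it is the ideal of A[x] generated by [I]. *)
Definition poly_values (K : fieldType) (P : K -> Prop) (x z : K) : Prop :=
  exists p : {poly K}, (forall i, P p`_i) /\ z = p.[x].

Lemma poly_values_const (K : fieldType) (P : K -> Prop) (x z : K) :
  P 0 -> P z -> poly_values P x z.
Proof.
by move=> P0 Pz; exists z%:P; rewrite hornerC; split=> // i; rewrite coefC; case: eqP.
Qed.

Lemma adjoin_proper (K : fieldType) (A I : K -> Prop) (x : K) :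
  proper_pair A I -> ~ poly_values I x 1 ->
  proper_pair (poly_values A x) (poly_values I x).
Proof.
move=> AI nI; have A0 := proper_zero AI; have I0 := proper_ideal0 AI.
split=> //.
- by apply: poly_values_const => //; apply: proper_one AI.
- move=> y z [p [Ap ->]] [q [Aq ->]]; exists (p - q); rewrite hornerD hornerN.
  by split=> // i; rewrite coefB; apply: (proper_sub AI).
- move=> y z [p [Ap ->]] [q [Aq ->]]; exists (p * q); rewrite hornerM.
  split=> // i; rewrite coefM; apply: (proper_sum AI) => j _; exact: proper_mul AI _ _ _ _.
- move=> y z [p [Ap ->]] [q [Aq ->]]; exists (p + q); rewrite hornerD.
  by split=> // i; rewrite coefD; apply: (proper_ideal_add AI).
- move=> y z [p [Ap ->]] [q [Aq ->]]; exists (p * q); rewrite hornerM.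
  split=> // i; rewrite coefM; apply: (proper_ideal_sum AI) => j _.
  exact: proper_ideal_mul AI _ _ _ _.
- exact: poly_values_const.
- by move=> y [p [Ip ->]]; exists p; split=> // i; apply: (proper_incl AI).
Qed.

Lemma adjoin_gen (K : fieldType) (A I : K -> Prop) (x : K) :
  proper_pair A I -> poly_values A x x.
Proof.
move=> AI; exists 'X; rewrite hornerX; split=> // i; rewrite coefX.
by case: eqP => _; [apply: proper_one AI | apply: proper_zero AI].
Qed.

(* Chevalley's argument: in a relation of minimal total degree the larger of
   the two degrees can be lowered using the other relation. *)
Lemma chevalley (K : fieldType) (A I : K -> Prop) (x : K) :
  proper_pair A I -> x != 0 ->
  ~ (poly_values I x 1 /\ poly_values I x^-1 1).
Proof.
move=> AI.
have A0 := proper_zero AI; have I0 := proper_ideal0 AI; have A1 := proper_one AI.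
(* Exchanging [x] and its inverse, [p] may be taken to have the larger size; the induction is on a
   bound [N] for the sum of the sizes. *)
suff main (N : nat) : forall (y : K) (p q : {poly K}), y != 0 ->
    (forall i, I p`_i) -> (forall i, I q`_i) -> 1 = p.[y] -> 1 = q.[y^-1] ->
    (size q <= size p)%N -> (size p + size q <= N)%N -> False.
  move=> x0 [[p [Ip p1]] [q [Iq q1]]]; have [le|lt] := leqP (size q) (size p).
    exact: (main _ x p q).
  apply: (main _ x^-1 q p); rewrite ?invrK ?invr_eq0 ?(ltnW lt) //.
elim: N => [|N IH] y p q y0 Ip Iq p1 q1 le_qp le_N.
  have /eqP : size p = 0%N by lia.
  by rewrite size_poly_eq0 => /eqP p0; move: p1; rewrite p0 horner0 => /eqP; rewrite oner_eq0.
have [sp1|sp1] := leqP (size p) 1.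
  by move: p1; rewrite (size1_polyC sp1) hornerC => p1; apply: (proper_proper AI); rewrite p1.
pose n := (size p).-1.
have np : n.+1 = size p by rewrite prednK //; lia.
have [b bE] : exists b, b = 1 - q`_0 by exists (1 - q`_0).
have [a aE] : exists a, a = p`_n by exists p`_n.
have Aq i : A q`_i by apply: (proper_incl AI).
have Ia : I a by rewrite aE.
have Ab : A b by rewrite bE; apply: (proper_sub AI).
(* Start from 1 = q_0 + b p(y). As b is the sum of the q_j y^(-j) for j > 0, its product with the
   leading term a y^n is a times a polynomial in y of degree below n. Substituting this gives [p'],
   of smaller size than [p], with value 1 at y. *)
pose p' : {poly K} := \poly_(i < n)
  ((i == 0%N)%:R * q`_0 + b * p`_i +
   a * (if (0 < n - i < size q)%N then q`_(n - i) else 0)).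
have Ip' i : I p'`_i.
  rewrite coef_poly; case: ifP => // _; apply: (proper_ideal_add AI).
    apply: (proper_ideal_add AI).
      by case: eqP; rewrite ?mul1r ?mul0r.
    exact: (proper_ideal_mul AI).
  rewrite mulrC; apply: (proper_ideal_mul AI) => //; by case: ifP.
have sp' : (size p' <= n)%N by apply: size_poly.
have p'1 : 1 = p'.[y].
  have bq : b = \sum_(j < n) q`_j.+1 * y^-1 ^+ j.+1.
    have sq : (size q <= n.+1)%N by rewrite np.
    rewrite bE {1}q1 (horner_coef_wide _ sq) big_ord_recl.
    by rewrite expr0 mulr1 addrC addKr.
  have -> : p'.[y] = q`_0 + b * (\sum_(i < n) p`_i * y ^+ i) +
     a * \sum_(i < n) q`_(n - i) * y ^+ i.
    rewrite horner_poly !mulr_sumr.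
    under eq_bigr do rewrite !mulrDl.
    rewrite !big_split /=; congr (_ + _ + _).
    - have n0 : (0 < n)%N by lia.
      rewrite (bigD1 (Ordinal n0)) //= big1 ?addr0 ?mul1r ?mulr1 //.
      by move=> i; rewrite -val_eqE /= => /negbTE->; rewrite !mul0r.
    - by apply: eq_bigr => i _; rewrite mulrA.
    - apply: eq_bigr => i _; rewrite -mulrA; congr (_ * (_ * _)).
      case: ifP => // /negbT h; rewrite nth_default //.
      by have := ltn_ord i; lia.
  have -> : \sum_(i < n) q`_(n - i) * y ^+ i = b * y ^+ n.
    rewrite bq mulr_suml [LHS](reindex_inj rev_ord_inj) /=; apply: eq_bigr => j _.
    rewrite subKn ?ltn_ord // -mulrA; congr (_ * _).
    have -> : y ^+ n = y ^+ (n - j.+1) * y ^+ j.+1 by rewrite -exprD subnK ?ltn_ord.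
    by rewrite mulrCA -exprMn mulVf // expr1n mulr1.
  have -> : \sum_(i < n) p`_i * y ^+ i = 1 - a * y ^+ n.
    by rewrite {1}p1 horner_coef -np big_ord_recr aE addrK.
  by rewrite bE; ring.
have [le|lt] := leqP (size q) (size p').
  apply: (IH y p' q) => //; lia.
apply: (IH y^-1 q p'); rewrite ?invrK ?invr_eq0 //; lia.
Qed.

(** Here x is invertible modulo [I], hence so are its powers. A relation 1 = p(1/x) with
    coefficients in [I], multiplied by a high power of x, would put that power in [I], and then 1
    too. *)
Lemma adjoin_inverse (K : fieldType) (A I : K -> Prop) (x : K) :
  proper_pair A I -> A x -> (exists a y, A a /\ I y /\ 1 = y + a * x) ->
  ~ poly_values I x^-1 1.
Proof.
move=> AI Ax [a [y [Aa [Iy e1]]]] [p [Ip p1]].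
have [x0|x0] := eqVneq x 0.
  by apply: (proper_proper AI); rewrite e1 x0 mulr0 addr0.
have Ayn n : exists z, I z /\ 1 = z + a ^+ n * x ^+ n.
  elim: n => [|n [z [Iz ez]]]; first by exists 0; rewrite !expr0 mulr1 add0r; split=> //; apply: proper_ideal0 AI.
  exists (y + a * x * z); split.
    apply: (proper_ideal_add AI) => //; apply: (proper_ideal_mul AI) => //.
    exact: (proper_mul AI).
  have -> : a ^+ n.+1 * x ^+ n.+1 = a * x * (1 - z).
    by rewrite {1}ez !exprS; ring.
  by rewrite {1}e1; ring.
have Aexp b n : A b -> A (b ^+ n).
  move=> Ab; elim: n => [|n IHn]; rewrite ?expr0 ?exprS; first exact: proper_one AI.
  exact: (proper_mul AI).
have Ixn : I (x ^+ size p).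
  rewrite -[x ^+ _]mulr1 p1 horner_coef mulr_sumr; apply: (proper_ideal_sum AI) => i _.
  rewrite mulrCA mulrC; apply: (proper_ideal_mul AI) => //.
  have -> : x ^+ size p = x ^+ (size p - i) * x ^+ i.
    by rewrite -exprD subnK // ltnW.
  rewrite -mulrA -exprMn divff // expr1n mulr1.
  exact: Aexp.
have [z [Iz ez]] := Ayn (size p).
apply: (proper_proper AI); rewrite ez; apply: (proper_ideal_add AI) => //.
by apply: (proper_ideal_mul AI) => //; apply: Aexp.
Qed.

(* The trichotomy v(x) > 0, v(x) = 0, v(x) < 0 for the valuation under construction. *)
Definition decided (K : fieldType) (A I : K -> Prop) (x : K) : Prop :=
  [\/ I x, A x /\ A x^-1 | I x^-1].

Definition extends (K : fieldType) (A I A' I' : K -> Prop) : Prop :=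
  (forall x, A x -> A' x) /\ (forall x, I x -> I' x).

(** If the ideal J = I + A x is proper, it replaces [I] and x gets positive valuation. Otherwise x
    is a unit modulo [I], its inverse can be adjoined, and x gets valuation 0. *)
Lemma decide_step_ring (K : fieldType) (A I : K -> Prop) (x : K) :
  proper_pair A I -> A x ->
  exists A' I', [/\ proper_pair A' I', extends A I A' I' & decided A' I' x].
Proof.
move=> AI Ax; have A0 := proper_zero AI; have I0 := proper_ideal0 AI.
pose J z := exists a y, A a /\ I y /\ z = y + a * x.
have [J1|nJ1] := EM (J 1).
  have nI := adjoin_inverse AI Ax J1.
  exists (poly_values A x^-1), (poly_values I x^-1); split.
  - exact: adjoin_proper.
  - by split=> z; apply: poly_values_const.
  - by apply: Or32; split; [apply: poly_values_const | apply: (adjoin_gen _ AI)].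
exists A, J; split.
- case: (AI) => A1 AB AM ID IM _ IA _; split=> //.
  + move=> _ _ [a [y [Aa [Iy ->]]]] [b [z [Ab [Iz ->]]]].
    exists (a + b), (y + z); split; first exact: proper_add AI _ _ _ _.
    by split; [exact: ID | ring].
  + move=> b _ Ab [a [y [Aa [Iy ->]]]]; exists (b * a), (b * y).
    by split; [exact: AM | split; [exact: IM | ring]].
  + by exists 0, 0; rewrite mul0r addr0.
  + move=> _ [a [y [Aa [Iy ->]]]]; apply: (proper_add AI); first exact: IA.
    exact: AM.
- split=> // z Iz; exists 0, z; by rewrite mul0r addr0.
- by apply: Or31; exists 1, 0; rewrite mul1r add0r; split=> //; apply: proper_one AI.
Qed.

(** By [chevalley], x or its inverse can be adjoined with the ideal remaining proper, which reduces
    to an element of the ring; [decided] is symmetric under inversion. *)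
Lemma decide_step (K : fieldType) (A I : K -> Prop) (x : K) :
  proper_pair A I -> x != 0 ->
  exists A' I', [/\ proper_pair A' I', extends A I A' I' & decided A' I' x].
Proof.
move=> AI x0; have A0 := proper_zero AI; have I0 := proper_ideal0 AI.
have step y : ~ poly_values I y 1 ->
    exists A' I', [/\ proper_pair A' I', extends A I A' I' & decided A' I' y].
  move=> nI; have AI' := adjoin_proper AI nI.
  have [A' [I' [AI'' [sA sI] dy]]] := decide_step_ring AI' (adjoin_gen y AI).
  exists A', I'; split=> //.
  by split=> z h; [apply: sA | apply: sI]; apply: poly_values_const.
have [nI|] := EM (~ poly_values I x 1); first exact: step.
move=> /contrapT Ix.
have [|A' [I' [AI' s dx]]] := step x^-1.
  by move=> Ix'; apply: (chevalley AI x0).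
exists A', I'; split=> //; case: dx; rewrite ?invrK.
- by move=> h; apply: Or33.
- by case=> h h'; apply: Or32.
- by move=> h; apply: Or31.
Qed.

(** Decisions persist under extension, so finitely many elements are treated one after the other,
    with no appeal to a maximal pair. *)
Lemma decide_seq (K : fieldType) (A I : K -> Prop) (s : seq K) :
  proper_pair A I -> (forall x, x \in s -> x != 0) ->
  exists A' I', [/\ proper_pair A' I', extends A I A' I'
    & forall x, x \in s -> decided A' I' x].
Proof.
elim: s A I => [|x s IH] A I AI s0; first by exists A, I.
have [|A1 [I1 [AI1 [sA1 sI1] dx]]] := decide_step AI (x := x).
  by apply: s0; rewrite inE eqxx.
have [|A2 [I2 [AI2 [sA2 sI2] ds]]] := IH _ _ AI1.
  by move=> y ys; apply: s0; rewrite inE ys orbT.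
exists A2, I2; split=> //; first by split=> z h; auto.
move=> y; rewrite inE => /predU1P[->|]; last exact: ds.
case: dx => [h|[h h']|h]; [apply: Or31|apply: Or32|apply: Or33]; auto.
Qed.

(** * Initial forms, Laurent monomials and specializations *)

Lemma initial_form_coef (N : nat) (w : 'I_N -> RR) (F : {mpoly CC[N]}) b :
  (initial_form w F)@_b =
  if (b \in msupp F) && all (fun a => Defs.mweight w b <= Defs.mweight w a) (msupp F)
  then F@_b else 0.
Proof.
rewrite /initial_form raddf_sum /=; have [bF|bF] := boolP (b \in msupp F).
  rewrite -big_filter; case: ifP => /= h.
    rewrite (bigD1_seq b) ?filter_uniq ?msupp_uniq ?mem_filter ?h //=.
    rewrite mcoeffZ mcoeffX eqxx mulr1 big1 ?addr0 // => a ab.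
    by rewrite mcoeffZ mcoeffX (negbTE ab) mulr0.
  rewrite big_filter big_seq_cond big1 // => a /andP[_ ha].
  rewrite mcoeffZ mcoeffX; have [ab|] := eqVneq a b; last by rewrite mulr0.
  by rewrite -ab ha in h.
rewrite big_seq_cond big1 // => a /andP[aF _].
rewrite mcoeffZ mcoeffX; have [ab|] := eqVneq a b; last by rewrite mulr0.
by rewrite -ab aF in bF.
Qed.

Lemma is_monomial_initial_form (N : nat) (w : 'I_N -> RR) (F : {mpoly CC[N]}) :
  is_monomial (initial_form w F) <->
  exists2 b, b \in msupp F &
    forall a, a \in msupp F -> a != b -> Defs.mweight w b < Defs.mweight w a.
Proof.
split=> [[c [b [c0 E]]]|[b bF bmin]].
  have := congr1 (mcoeff b) E; rewrite initial_form_coef mcoeffZ mcoeffX eqxx mulr1.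
  case: ifP => [/andP[bF bmin] _|_ c00]; last by rewrite -c00 eqxx in c0.
  exists b => // a aF ab; rewrite lt_neqAle (allP bmin _ aF) andbT; apply/eqP => wab.
  have := congr1 (mcoeff a) E; rewrite initial_form_coef mcoeffZ mcoeffX aF -wab bmin /=.
  rewrite eq_sym (negbTE ab) mulr0 => /eqP.
  by move: aF; rewrite mcoeff_msupp => /negbTE->.
exists F@_b, b; split; first by rewrite -mcoeff_msupp.
apply/mpolyP => a; rewrite initial_form_coef mcoeffZ mcoeffX.
have [<-|ba] := eqVneq b a.
  rewrite bF mulr1 /=; case: allP => // -[] a' a'F.
  by have [->//|/(bmin _ a'F)/ltW] := eqVneq a' b.
rewrite mulr0; case: ifP => // /andP[aF /allP/(_ _ bF)].
by rewrite leNgt bmin // eq_sym.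
Qed.

Definition laurent (K : fieldType) (N : nat) (c : 'I_N -> K) (e : 'I_N -> int) : K :=
  \prod_i c i ^ e i.

Lemma laurentD (K : fieldType) (N : nat) (c : 'I_N -> K) (e f : 'I_N -> int) :
  (forall i, c i != 0) ->
  laurent c (fun i => e i + f i) = laurent c e * laurent c f.
Proof.
by move=> c0; rewrite -big_split; apply: eq_bigr => i _; rewrite expfzDr.
Qed.

Lemma laurentN (K : fieldType) (N : nat) (c : 'I_N -> K) (e : 'I_N -> int) :
  laurent c (fun i => - e i) = (laurent c e)^-1.
Proof. by rewrite /laurent -prodfV; apply: eq_bigr => i _; rewrite invr_expz. Qed.

Definition eweight (N : nat) (u : 'I_N -> RR) (e : 'I_N -> int) : RR :=
  \sum_i (e i)%:~R * u i.

Lemma eweightD (N : nat) (u : 'I_N -> RR) (e f : 'I_N -> int) :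
  eweight u (fun i => e i + f i) = eweight u e + eweight u f.
Proof. by rewrite -big_split; apply: eq_bigr => i _; rewrite rmorphD mulrDl. Qed.

(** Weights at least 0 give the initial ring, positive weights its ideal. Exponents may repeat in
    the list, so that sums are concatenations. *)
Definition laurent_span (K : fieldType) (iota : CC -> K) (N : nat) (c : 'I_N -> K)
    (u : 'I_N -> RR) (P : pred RR) (z : K) : Prop :=
  exists s : seq (CC * ('I_N -> int)),
    all (fun t => P (eweight u t.2)) s /\
    z = \sum_(t <- s) iota t.1 * laurent c t.2.

Lemma laurent_span_gen (K : fieldType) (iota : {rmorphism CC -> K}) (N : nat)
    (c : 'I_N -> K) (u : 'I_N -> RR) (P : pred RR) e :
  P (eweight u e) -> laurent_span iota c u P (laurent c e).
Proof.
by move=> Pe; exists [:: (1, e)]; rewrite /= Pe big_seq1 rmorph1 mul1r.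
Qed.

Lemma laurent_spanD (K : fieldType) (iota : CC -> K) (N : nat)
    (c : 'I_N -> K) (u : 'I_N -> RR) (P : pred RR) x y :
  laurent_span iota c u P x -> laurent_span iota c u P y ->
  laurent_span iota c u P (x + y).
Proof.
move=> [s [Ps ->]] [t [Pt ->]]; exists (s ++ t).
by rewrite all_cat Ps Pt big_cat.
Qed.

Lemma laurent_spanM (K : fieldType) (iota : {rmorphism CC -> K}) (N : nat)
    (c : 'I_N -> K) (u : 'I_N -> RR) (P Q S : pred RR) x y :
  (forall i, c i != 0) -> (forall a b, P a -> Q b -> S (a + b)) ->
  laurent_span iota c u P x -> laurent_span iota c u Q y ->
  laurent_span iota c u S (x * y).
Proof.
move=> c0 PQS [s [Ps ->]] [t [Qt ->]].
elim: s Ps => [_|a s IH /= /andP[Pa Ps]]; first by exists [::]; rewrite !big_nil mul0r.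
rewrite big_cons mulrDl; apply: laurent_spanD; last exact: IH.
elim: t Qt {IH} => [_|b t IHt /= /andP[Qb Qt]]; first by exists [::]; rewrite !big_nil mulr0.
rewrite big_cons mulrDr; apply: laurent_spanD; last exact: IHt.
exists [:: (a.1 * b.1, fun i => a.2 i + b.2 i)]; rewrite /= eweightD PQS // big_seq1 /=.
by split=> //; rewrite rmorphM laurentD //; ring.
Qed.

(* If 1 were in the span of the Laurent monomials of positive weight, clearing
   denominators would give a relation whose initial form is a monomial. *)
Lemma laurent_span_proper (K : fieldType) (iota : {rmorphism CC -> K}) (N : nat)
    (c : 'I_N -> K) (u : 'I_N -> RR) :
  (forall i, c i != 0) ->
  (forall F : {mpoly CC[N]}, F != 0 -> mmap iota c F = 0 ->
    ~ is_monomial (initial_form u F)) ->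
  proper_pair (laurent_span iota c u (fun a => 0 <= a))
              (laurent_span iota c u (fun a => 0 < a)).
Proof.
move=> c0 trop.
have Z P : laurent_span iota c u P 0 by exists [::]; rewrite big_nil.
have opp P x : laurent_span iota c u P x -> laurent_span iota c u P (- x).
  move=> [s [Ps ->]]; exists [seq (- t.1, t.2) | t <- s]; rewrite all_map; split=> //.
  by rewrite big_map -sumrN; apply: eq_bigr => t _; rewrite rmorphN mulNr.
split=> //.
- have <- : laurent c (fun _ => 0) = 1 by rewrite /laurent big1 // => i _; rewrite expr0z.
  by apply: laurent_span_gen; rewrite /eweight big1 // => i _; rewrite mul0r.
- by move=> x y Ax Ay; apply: laurent_spanD => //; apply: opp.
- by move=> x y; apply: laurent_spanM => // a b; apply: addr_ge0.
- by move=> x y; apply: laurent_spanD.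
- by move=> x y; apply: laurent_spanM => // a b; apply: ltr_wpDl.
- by move=> x [s [Ps ->]]; exists s; split=> //; apply: sub_all Ps => t /ltW.
move=> [s [Ps e1]]; pose d : CC * ('I_N -> int) := (0, fun _ => 0).
pose T (j : 'I_(size s)) := nth d s j.
have TP j : 0 < eweight u (T j).2 by apply: (all_nthP d Ps).
have {}e1 : 1 = \sum_j iota (T j).1 * laurent c (T j).2.
  by rewrite [LHS]e1 (big_nth d) big_mkord.
(* A common denominator: adding [b] makes every exponent of the relation nonnegative. *)
pose b : 'X_{1.. N} := [multinom (\sum_j absz ((T j).2 i))%N | i < N].
pose mt j : 'X_{1.. N} := [multinom absz ((b i)%:Z + (T j).2 i)%R | i < N].
have mtE j i : (mt j i)%:Z = (b i)%:Z + (T j).2 i.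
  by rewrite mnmE mnmE (bigD1 j) //=; lia.
have mtW j : Defs.mweight u (mt j) = Defs.mweight u b + eweight u (T j).2.
  rewrite /Defs.mweight /eweight -big_split; apply: eq_bigr => i _ /=.
  by rewrite !pmulrn mtE rmorphD mulrDl.
have mtb j : mt j != b.
  by apply/eqP => eb; have := mtW j; have := TP j; rewrite eb; lra.
(* Every [mt j] has larger weight than [b], so the term in [b] has coefficient 1 and is the whole
   initial form. *)
pose F : {mpoly CC[N]} := 'X_[b] - \sum_j (T j).1 *: 'X_[mt j].
have FE a : F@_a = (b == a)%:R - \sum_j (T j).1 * (mt j == a)%:R.
  rewrite mcoeffB mcoeffX raddf_sum; congr (_ - _); apply: eq_bigr => j _ /=.
  by rewrite mcoeffZ mcoeffX.
have Fb : F@_b = 1.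
  by rewrite FE eqxx big1 ?subr0 // => j _; rewrite (negbTE (mtb j)) mulr0.
have bF : b \in msupp F by rewrite mcoeff_msupp Fb oner_eq0.
apply: (trop F).
- by apply: contraTneq bF => ->; rewrite msupp0.
- have mmapX a : mmap iota c 'X_[a] = \prod_i c i ^+ a i by rewrite mmapX.
  rewrite mmapB mmapX.
  have E j : mmap iota c ((T j).1 *: 'X_[mt j]) =
      (\prod_i c i ^+ b i) * (iota (T j).1 * laurent c (T j).2).
    rewrite mmapZ mmapX mulrCA; congr (_ * _); rewrite -big_split.
    by apply: eq_bigr => i _ /=; rewrite !exprnP mtE expfzDr.
  have S : mmap iota c (\sum_j (T j).1 *: 'X_[mt j]) =
      (\prod_i c i ^+ b i) * \sum_j iota (T j).1 * laurent c (T j).2.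
    by rewrite raddf_sum mulr_sumr; apply: eq_bigr => j _; apply: E.
  by rewrite S -e1 mulr1 subrr.
- apply/is_monomial_initial_form; exists b => // a.
  rewrite mcoeff_msupp FE [b == a]eq_sym => Fa /negbTE ab; move: Fa; rewrite ab sub0r oppr_eq0.
  have [|nex] := boolP [exists j, mt j == a].
    by case/existsP => j /eqP<- _; rewrite mtW ltrDl TP.
  rewrite big1 ?eqxx // => j _; move: nex; rewrite negb_exists => /forallP/(_ j)/negbTE->.
  by rewrite mulr0.
Qed.

(** The value z = e(p) / e(q) of the fraction f = p / q. It is a relation because f has a value only
    if some denominator survives under [e]. *)
Definition specializes (D : idomainType) (k : fieldType) (e : D -> k)
    (f : {fraction D}) (z : k) : Prop :=
  exists p q : D, [/\ e q != 0, f * tofrac q = tofrac p & z * e q = e p].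

Lemma specializes_const (D : idomainType) (k : fieldType) (e : {rmorphism D -> k}) p :
  specializes e (tofrac p) (e p).
Proof. by exists p, 1; rewrite !rmorph1 !mulr1 oner_eq0. Qed.

Lemma specializesD (D : idomainType) (k : fieldType) (e : {rmorphism D -> k}) f g y z :
  specializes e f y -> specializes e g z -> specializes e (f + g) (y + z).
Proof.
move=> [p [q [q0 fE yE]]] [p' [q' [q'0 gE zE]]].
exists (p * q' + p' * q), (q * q'); rewrite !rmorphD !rmorphM mulf_neq0 //=.
by split=> //; [rewrite -fE -gE | rewrite -yE -zE]; ring.
Qed.

Lemma specializesM (D : idomainType) (k : fieldType) (e : {rmorphism D -> k}) f g y z :
  specializes e f y -> specializes e g z -> specializes e (f * g) (y * z).
Proof.
move=> [p [q [q0 fE yE]]] [p' [q' [q'0 gE zE]]].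
exists (p * p'), (q * q'); rewrite !rmorphM mulf_neq0 //=.
by split=> //; [rewrite -fE -gE | rewrite -yE -zE]; ring.
Qed.

Lemma specializesV (D : idomainType) (k : fieldType) (e : {rmorphism D -> k}) f z :
  z != 0 -> specializes e f z -> specializes e f^-1 z^-1.
Proof.
move=> z0 [p [q [q0 fE zE]]].
have p0 : e p != 0 by rewrite -zE mulf_neq0.
have f0 : f != 0.
  apply: contraNneq p0 => f0; move: fE; rewrite f0 mul0r => /esym/eqP.
  by rewrite tofrac_eq0 => /eqP->; rewrite rmorph0.
by exists q, p; split=> //; rewrite -?fE -?zE mulrA mulVf ?mul1r.
Qed.

Lemma specializesX (D : idomainType) (k : fieldType) (e : {rmorphism D -> k}) f z n :
  specializes e f z -> specializes e (f ^+ n) (z ^+ n).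
Proof.
move=> fz; elim: n => [|n IH]; last by rewrite !exprS; apply: specializesM.
by rewrite !expr0 -(rmorph1 e) -(rmorph1 (@tofrac D)); apply: specializes_const.
Qed.

Lemma specializes_exprz (D : idomainType) (k : fieldType) (e : {rmorphism D -> k}) f z
    (a : int) :
  z != 0 -> specializes e f z -> specializes e (f ^ a) (z ^ a).
Proof.
move=> z0 fz; case: a => a; first exact: specializesX.
by rewrite !NegzE -!exprnN; apply: specializesV; [rewrite expf_neq0 | apply: specializesX].
Qed.

Lemma specializes_prod (D : idomainType) (k : fieldType) (e : {rmorphism D -> k})
    (J : finType) (f : J -> {fraction D}) (z : J -> k) :
  (forall j, specializes e (f j) (z j)) ->
  specializes e (\prod_j f j) (\prod_j z j).
Proof.
move=> fz; apply: (big_rec2 (specializes e)) => [|j x y _]; last exact: specializesM.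
by rewrite -(rmorph1 e) -(rmorph1 (@tofrac D)); apply: specializes_const.
Qed.

Lemma specializes_sum (D : idomainType) (k : fieldType) (e : {rmorphism D -> k})
    (J : Type) (s : seq J) (f : J -> {fraction D}) (z : J -> k) :
  (forall j, specializes e (f j) (z j)) ->
  specializes e (\sum_(j <- s) f j) (\sum_(j <- s) z j).
Proof.
move=> fz; apply: (big_rec2 (specializes e)) => [|j x y _]; last exact: specializesD.
by rewrite -(rmorph0 e) -(rmorph0 (@tofrac D)); apply: specializes_const.
Qed.

(** This carries an equation from the generic point to its specializations. *)
Lemma specializes0 (D : idomainType) (k : fieldType) (e : {rmorphism D -> k}) z :
  specializes e 0 z -> z = 0.
Proof.
move=> [p [q [q0]]]; rewrite mul0r => /esym/eqP; rewrite tofrac_eq0 => /eqP->.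
by rewrite rmorph0 => /eqP; rewrite mulf_eq0 (negbTE q0) orbF => /eqP.
Qed.

(** * Relations of degree at most k *)

Definition incr (n : nat) (a : 'I_n -> nat) (j : 'I_n) : 'I_n -> nat :=
  fun l => (a l + (l == j))%N.

Lemma sum_incr (n : nat) (a : 'I_n -> nat) (j : 'I_n) :
  (\sum_l incr a j l = (\sum_l a l).+1)%N.
Proof.
rewrite big_split /= -addn1; congr (_ + _)%N.
by rewrite (bigD1 j) //= eqxx big1 // => l /negbTE->.
Qed.

Lemma incr_ex (n N : nat) (a : 'I_n -> nat) :
  (\sum_l a l = N.+1)%N -> exists a' j, a = incr a' j.
Proof.
move=> aN; have [/existsP[j aj]|] := boolP [exists j, 0 < a j]%N.
  exists (fun l => a l - (l == j))%N, j; apply/funext => l; rewrite /incr.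
  by case: eqP => [->|_]; rewrite ?subn0 ?addn0 // subnK.
rewrite negb_exists => /forallP a0; move: aN; rewrite big1 // => l _.
by have := a0 l; case: (a l).
Qed.

(** Interpolates between products of falling factorials (b = 0) and monomials (a = 0). *)
Definition mixed (K : fieldType) (n : nat) (rho : 'I_n -> int) (a b : 'I_n -> nat) : K :=
  \prod_j ((ffz (rho j) (a j))%:~R * (rho j)%:~R ^+ b j).

(** One factor rho_j is split as (rho_j - a_j) + a_j, and the first part extends the falling
    factorial. *)
Lemma mixed_incr (K : fieldType) (n : nat) (rho : 'I_n -> int) a b j :
  mixed K rho a (incr b j) = mixed K rho (incr a j) b + (a j)%:R * mixed K rho a b.
Proof.
rewrite /mixed !(bigD1 (P := predT) j) //= /incr eqxx !addn1.
have -> : \prod_(l < n | l != j) ((ffz (rho l) (a l))%:~R * (rho l)%:~R ^+ (b l + (l == j)))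
   = \prod_(l < n | l != j) ((ffz (rho l) (a l))%:~R * (rho l)%:~R ^+ b l) :> K.
  by apply: eq_bigr => l /negbTE->; rewrite addn0.
have -> : \prod_(l < n | l != j) ((ffz (rho l) (a l + (l == j)))%:~R * (rho l)%:~R ^+ b l)
   = \prod_(l < n | l != j) ((ffz (rho l) (a l))%:~R * (rho l)%:~R ^+ b l) :> K.
  by apply: eq_bigr => l /negbTE->; rewrite addn0.
rewrite /ffz big_ord_recr /= rmorphM rmorphB /= -pmulrn exprS; ring.
Qed.

(* Falling factorials of degree at most [k] and powers of degree at most [k]
   span the same space of polynomials. *)
Lemma ffz_relations (K : fieldType) (n m k : nat) (r : 'I_m.+1 -> 'I_n -> int)
    (d : 'I_m.+1 -> K) :
  (forall a : 'I_n -> nat, (\sum_j a j <= k)%N ->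
     \sum_i d i * (\prod_j ffz (r i j) (a j))%:~R = 0) <->
  (forall b : 'I_n -> nat, (\sum_j b j <= k)%N ->
     \sum_i d i * \prod_j (r i j)%:~R ^+ b j = 0).
Proof.
pose G a b := \sum_i d i * mixed K (r i) a b.
have Gstep a b j : G a (incr b j) = G (incr a j) b + (a j)%:R * G a b.
  rewrite /G mulr_sumr -big_split; apply: eq_bigr => i _ /=.
  by rewrite mixed_incr; ring.
have G0r a : \sum_i d i * (\prod_j ffz (r i j) (a j))%:~R = G a (fun=> 0%N).
  apply: eq_bigr => i _; congr (_ * _); rewrite rmorph_prod.
  by apply: eq_bigr => j _; rewrite expr0 mulr1.
have G0l b : \sum_i d i * \prod_j (r i j)%:~R ^+ b j = G (fun=> 0%N) b.
  apply: eq_bigr => i _; congr (_ * _).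
  by apply: eq_bigr => j _; rewrite /ffz big_ord0 mul1r.
have nil (a : 'I_n -> nat) : (\sum_j a j = 0)%N -> a = fun=> 0%N.
  move=> /eqP; rewrite sum_nat_eq0 => /forallP a0.
  by apply/funext => j; apply/eqP; apply: (a0 j).
split=> [H b|H a].
  (* Powers are traded one by one for falling factors, while the total degree of [a] and [b'] stays
     at most [k]. *)
  rewrite G0l; suff main N : forall a b', (\sum_j b' j = N)%N ->
      (\sum_j a j + N <= k)%N -> G a b' = 0.
    by move=> bk; apply: (main (\sum_j b j)%N) => //; rewrite big1.
  elim: N => [|N IH] a b' bN; first by rewrite (nil _ bN) addn0 -G0r; apply: H.
  move=> le; have [c [j bE]] := incr_ex bN.
  move: bN; rewrite bE sum_incr => -[cN]; rewrite Gstep !IH ?mulr0 ?addr0 ?sum_incr //; lia.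
rewrite G0r; suff main N : forall a' b, (\sum_j a' j = N)%N ->
    (\sum_j b j + N <= k)%N -> G a' b = 0.
  by move=> ak; apply: (main (\sum_j a j)%N) => //; rewrite big1.
elim: N => [|N IH] a' b aN; first by rewrite (nil _ aN) addn0 -G0l; apply: H.
move=> le; have [c [j aE]] := incr_ex aN.
move: aN; rewrite aE sum_incr => -[cN].
have := Gstep c b j; rewrite (IH c b) //; last by lia.
by rewrite (IH c) ?sum_incr ?mulr0 ?addr0 //; lia.
Qed.

(** Multiplying the derivative of order alpha by x^alpha leaves the monomial times falling
    factorials, which are then exchanged for powers. *)
Lemma osc_hyperplaneE (n m : nat) (r : 'I_m.+1 -> 'I_n -> int) (k : nat)
    (x : 'I_n -> CC) (c : 'I_m.+1 -> CC) : torus_pt x ->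
  osc_hyperplane r k x c <->
  (forall b : 'I_n -> nat, (\sum_j b j <= k)%N ->
     \sum_i (c i * laurent x (r i)) * \prod_j (r i j)%:~R ^+ b j = 0).
Proof.
move=> x0; rewrite -ffz_relations.
have E a : \sum_i (c i * laurent x (r i)) * (\prod_j ffz (r i j) (a j))%:~R =
    (\sum_i c i * dmon (r i) a x) * \prod_j x j ^+ a j.
  rewrite mulr_suml; apply: eq_bigr => i _; rewrite /dmon -!mulrA; congr (_ * _).
  rewrite mulrC; congr (_ * _); rewrite -big_split; apply: eq_bigr => j _ /=.
  by rewrite exprnP -expfzDr // subrK.
have X0 a : \prod_j x j ^+ a j != 0 by apply/prodf_neq0 => j _; rewrite expf_neq0.
split=> H a /H; rewrite ?E; first by move=> ->; rewrite mul0r.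
by move/eqP; rewrite mulf_eq0 (negbTE (X0 a)) orbF => /eqP.
Qed.

(** Columns are the values at the r_i of the monomials of degree at most k. The left kernel is the
    space L, and the column space consists of the vectors (Q(r_i)) with deg Q <= k. *)
Definition power_mx (K : fieldType) (n m : nat) (r : 'I_m.+1 -> 'I_n -> int) (k : nat) :
    'M[K]_(m.+1, #|{: 'X_{1.. n < k.+1}}|) :=
  \matrix_(i, b) \prod_j (r i j)%:~R ^+ (bmnm (enum_val b) j).

Lemma power_mx_relations (K : fieldType) (n m : nat) (r : 'I_m.+1 -> 'I_n -> int)
    (k : nat) (d : 'rV[K]_m.+1) :
  d *m power_mx K r k = 0 <->
  (forall b : 'I_n -> nat, (\sum_j b j <= k)%N ->
     \sum_i d 0 i * \prod_j (r i j)%:~R ^+ b j = 0).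
Proof.
split=> [dM b bk|H].
  have degb : (mdeg [multinom b j | j < n] < k.+1)%N.
    by rewrite mdegE; under eq_bigr do rewrite mnmE.
  have /matrixP/(_ 0 (enum_rank (BMultinom degb))) := dM.
  rewrite !mxE => E; rewrite -[RHS]E; apply: eq_bigr => i _.
  rewrite mxE enum_rankK; congr (_ * _); apply: eq_bigr => j _.
  by rewrite /= mnmE.
apply/rowP => b; rewrite !mxE -[RHS](H (bmnm (enum_val b))).
  by apply: eq_bigr => i _; rewrite mxE.
by rewrite -mdegE -ltnS; apply: bmdeg.
Qed.

Definition poly_of_col (n k : nat) (X : 'cV[rat]_#|{: 'X_{1.. n < k.+1}}|) :
    {mpoly rat[n]} := \sum_b X b 0 *: 'X_[bmnm (enum_val b)].

Lemma poly_of_col_deg (n k : nat) (X : 'cV[rat]_#|{: 'X_{1.. n < k.+1}}|) :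
  deg_le (poly_of_col X) k.
Proof.
rewrite /deg_le /poly_of_col; apply: (big_ind (fun Q => msize Q <= k.+1)%N).
- by rewrite msize0.
- by move=> P Q hP hQ; rewrite (leq_trans (msizeD_le _ _)) // geq_max hP.
- by move=> b _; rewrite (leq_trans (msizeZ_le _ _)) // msizeX; apply: bmdeg.
Qed.

Lemma evalQ_poly_of_col (n m k : nat) (r : 'I_m.+1 -> 'I_n -> int)
    (X : 'cV[rat]_#|{: 'X_{1.. n < k.+1}}|) i :
  evalQ (poly_of_col X) (r i) = (power_mx rat r k *m X) i 0.
Proof.
rewrite /evalQ /poly_of_col raddf_sum /= mxE; apply: eq_bigr => b _.
by rewrite mevalZ mevalX mxE mulrC.
Qed.

Lemma evalQ_relation (K : fieldType) (phi : {rmorphism rat -> K}) (n m k : nat)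
    (r : 'I_m.+1 -> 'I_n -> int) (d : 'I_m.+1 -> K) (Q : {mpoly rat[n]}) :
  deg_le Q k ->
  (forall b : 'I_n -> nat, (\sum_j b j <= k)%N ->
     \sum_i d i * \prod_j (r i j)%:~R ^+ b j = 0) ->
  \sum_i phi (evalQ Q (r i)) * d i = 0.
Proof.
move=> degQ H.
have E i : phi (evalQ Q (r i)) = \sum_(b <- msupp Q) phi Q@_b * \prod_j (r i j)%:~R ^+ b j.
  rewrite /evalQ mevalE rmorph_sum; apply: eq_bigr => b _ /=.
  rewrite rmorphM rmorph_prod; congr (_ * _); apply: eq_bigr => j _ /=.
  by rewrite rmorphXn /= rmorph_int.
under eq_bigr do rewrite E mulr_suml.
rewrite exchange_big big_seq big1 //= => b bQ.
under eq_bigr do rewrite -mulrA [_ * d _]mulrC.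
rewrite -mulr_sumr H ?mulr0 // -mdegE -ltnS.
exact: leq_trans (msize_mdeg_lt bQ) degQ.
Qed.

(** Linear duality: what all left relations of [B] annihilate lies in its column space, because B
    times its pseudo-inverse differs from 1 by a left multiple of [kermx B]. *)
Lemma mulmx_kermx_factor (K : fieldType) (p q s : nat) (B : 'M[K]_(p, q)) (C : 'M[K]_(p, s)) :
  kermx B *m C = 0 -> B *m (pinvmx B *m C) = C.
Proof.
move=> kC; rewrite mulmxA.
have -> : B *m pinvmx B = 1%:M - col_ebase B *m kermx B.
  rewrite -{1}[B]mulmx_ebase /pinvmx /kermx -!mulmxA.
  rewrite (mulmxA (row_ebase B)) mulmxV ?row_ebase_unit // mul1mx.
  rewrite (mulmxA (pid_mx _)) pid_mx_id ?rank_leq_col //.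
  apply/eqP; rewrite eq_sym subr_eq; apply/eqP; rewrite !mulmxA -mulmxDl -mulmxDr.
  by rewrite /copid_mx addrC subrK mulmx1 mulmxV ?col_ebase_unit.
by rewrite mulmxBl mul1mx -mulmxA kC mulmx0 subr0.
Qed.

(** [D] keeps the indices j with v_j <= v_i. If every left relation of D M vanished at i, duality
    would give a Q of degree at most k with Q(r_i) = 1 and Q(r_j) = 0 at the other kept j; its Euler
    derivative would attain its minimum at i alone. *)
Lemma euler_initial_vector (n m : nat) (r : 'I_m.+1 -> 'I_n -> int) (k : nat)
    (u : 'I_m.+1 -> RR) (w : 'I_n -> RR) :
  (forall Q : {mpoly rat[n]}, deg_le Q k -> in_V_euler r u Q w) ->
  forall i, exists z : 'rV[rat]_m.+1, [/\ z *m power_mx rat r k = 0, z 0 i != 0 &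
    forall j, trop_term r u w i < trop_term r u w j -> z 0 j = 0].
Proof.
move=> V i; set v := trop_term r u w.
pose D : 'M[rat]_m.+1 := diag_mx (\row_j (v j <= v i)%R%:R).
have DE (y : 'rV_m.+1) j : (y *m D) 0 j = y 0 j * (v j <= v i)%R%:R.
  by rewrite mul_mx_diag !mxE.
have DE' q (y : 'M_(m.+1, q)) j l : (D *m y) j l = (v j <= v i)%R%:R * y j l.
  by rewrite mul_diag_mx !mxE.
pose M := power_mx rat r k.
have [k0|] := eqVneq (kermx (D *m M) *m (delta_mx i 0 : 'cV_m.+1)) 0.
  have := mulmx_kermx_factor k0; set X := (_ *m delta_mx i 0); rewrite -mulmxA => DMX.
  have eX j : v j <= v i -> (M *m X) j 0 = (j == i)%:R.
    move=> vj; have /matrixP/(_ j 0) := DMX.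
    by rewrite DE' vj mul1r => ->; rewrite mxE eqxx andbT.
  have := V _ (poly_of_col_deg X); case=> [/(_ i)/eqP|[p [q [pq p0 q0 vpq pmin]]]].
    by rewrite evalQ_poly_of_col eX // eqxx oner_eq0.
  have vpi : v p <= v i.
    by apply: pmin; rewrite evalQ_poly_of_col eX // eqxx oner_eq0.
  have single j : v j <= v i -> evalQ (poly_of_col X) (r j) != 0 -> j = i.
    move=> vj; rewrite evalQ_poly_of_col eX //; by case: (j =P i) => // _; rewrite eqxx.
  have pi := single p vpi p0.
  have qi : q = i by apply: single => //; rewrite /v -vpq.
  by rewrite pi qi eqxx in pq.
rewrite -colE => /cV0Pn[l]; rewrite mxE => kl.
exists (row l (kermx (D *m M)) *m D); split.
- by rewrite -mulmxA -row_mul mulmx_ker row0.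
- by rewrite DE mxE lexx mulr1.
- by move=> j; rewrite DE => /lt_geF->; rewrite mulr0.
Qed.

(** The Euler derivative depends only on the set of i with Q(r_i) nonzero, so one Q for each set
    that occurs suffices. *)
Lemma finite_euler_family (n m : nat) (r : 'I_m.+1 -> 'I_n -> int) (k : nat)
    (u : 'I_m.+1 -> RR) :
  exists Qs : seq {mpoly rat[n]},
    all (fun Q => deg_le Q k) Qs /\
    forall w : 'I_n -> RR,
      (forall Q, Q \in Qs -> in_V_euler r u Q w) <->
      (forall Q : {mpoly rat[n]}, deg_le Q k -> in_V_euler r u Q w).
Proof.
pose supp Q : {set 'I_m.+1} := [set i | evalQ Q (r i) != 0].
have V_supp Q Q' w : supp Q = supp Q' -> in_V_euler r u Q w -> in_V_euler r u Q' w.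
  move=> /setP E; have {}E i : (evalQ Q (r i) != 0) = (evalQ Q' (r i) != 0).
    by have := E i; rewrite !inE.
  case=> [Q0|[i [j [ij Qi Qj vij vmin]]]].
    by left=> i; apply/eqP/negPn; rewrite -E Q0 eqxx.
  by right; exists i, j; split; rewrite -?E // => l; rewrite -E; apply: vmin.
suff [Qs [degQs supQs]] : exists Qs : seq {mpoly rat[n]},
    all (fun Q => deg_le Q k) Qs /\
    forall Q, deg_le Q k -> supp Q \in enum {set 'I_m.+1} -> exists2 Q', Q' \in Qs & supp Q' = supp Q.
  exists Qs; split=> // w; split=> H Q; last by move=> /(allP degQs)/H.
  by move=> /supQs[|Q' /H VQ' E]; [rewrite mem_enum | apply: V_supp VQ'].
elim: (enum _) => [|S s [Qs [degQs IH]]]; first by exists [::].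
have [[Q degQ <-]|nQ] := EM (exists2 Q, deg_le Q k & supp Q = S).
  exists (Q :: Qs); split=> [|Q' degQ']; first by rewrite /= degQ.
  rewrite inE => /predU1P[->|/(IH _ degQ')[Q'' Q''s]].
    by exists Q; rewrite ?inE ?eqxx.
  by exists Q''; rewrite // inE Q''s orbT.
exists Qs; split=> // Q degQ; rewrite inE => /predU1P[QS|]; last exact: IH.
by case: nQ; exists Q.
Qed.

(** * From the tropicalization to the intersection *)

(** Membership of d_j / d_i in [A] is a total preorder. If a minimal d_i with l_i nonzero had no
    equivalent competitor, dividing the relation by l_i d_i would express 1 through the other
    quotients, all in [I]. *)
Lemma min_attained_twice (K : fieldType) (A I : K -> Prop) (N : nat)
    (d l : 'I_N -> K) :
  proper_pair A I -> (forall i, d i != 0) ->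
  (forall i j, decided A I (d j / d i)) ->
  (forall i, l i != 0 -> A (l i) /\ A (l i)^-1) ->
  \sum_i l i * d i = 0 -> (exists i, l i != 0) ->
  exists i j, [/\ i != j, l i != 0 /\ l j != 0, A (d j / d i), A (d i / d j) &
    forall h, l h != 0 -> A (d h / d i)].
Proof.
move=> AI d0 dec lA ld0 [i0 li0].
have dV i j : (d j / d i)^-1 = d i / d j by rewrite invf_div.
have A1 := proper_one AI.
have total i j : A (d j / d i) \/ A (d i / d j).
  case: (dec i j); rewrite ?dV.
  - by move/(proper_incl AI); left.
  - by case; left.
  - by move/(proper_incl AI); right.
have trans i j h : A (d j / d i) -> A (d h / d j) -> A (d h / d i).
  move=> ij jh; have -> : d h / d i = d h / d j * (d j / d i) by rewrite mulrA divfK.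
  exact: (proper_mul AI).
have [i li imin] : exists2 i, l i != 0 & forall h, l h != 0 -> A (d h / d i).
  suff : forall s : seq 'I_N, (exists2 i, i \in s & l i != 0) ->
      exists2 i, l i != 0 & forall h, h \in s -> l h != 0 -> A (d h / d i).
    case/(_ (enum 'I_N)) => [|i li imin]; first by exists i0; rewrite ?mem_enum.
    by exists i => // h; apply: imin; rewrite mem_enum.
  elim=> [|j s IH] [g0]; rewrite ?in_nil //.
  have [/hasP[i' i's li']|/hasPn none] := boolP (has (fun i => l i != 0) s).
    move=> _ _.
    have [|h lh hmin] := IH; first by exists i'.
    have [lj|lj] := eqVneq (l j) 0.
      by exists h => // g; rewrite inE => /predU1P[->|/hmin//]; rewrite lj eqxx.
    have [hj|jh] := total h j.
      by exists h => // g; rewrite inE => /predU1P[->|/hmin//].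
    exists j => // g; rewrite inE => /predU1P[->|gs lg]; first by rewrite divff.
    by apply: trans jh _; apply: hmin.
  have {}none g : g \in s -> l g = 0 by move/none; rewrite negbK => /eqP.
  rewrite inE => /predU1P[->|/none->]; last by rewrite eqxx.
  move=> lj; exists j => // g; rewrite inE => /predU1P[->|/none->]; last by rewrite eqxx.
  by rewrite divff.
have [[j [ji lj Aij]]|nj] := EM (exists j, [/\ j != i, l j != 0 & A (d i / d j)]).
  by exists i, j; split=> //; [rewrite eq_sym | apply: imin].
case: (proper_proper AI).
have Ih h : h != i -> l h != 0 -> I (d h / d i).
  move=> hi lh; case: (dec i h) => //; rewrite dV.
    by case=> _ Aih; case: nj; exists h.
  by move=> /(proper_incl AI) Aih; case: nj; exists h.
have -> : 1 = - ((l i)^-1 * \sum_(h | h != i) l h * (d h / d i)).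
  move: ld0; rewrite (bigD1 i) //= => /eqP; rewrite addrC addr_eq0 => /eqP E.
  under eq_bigr do rewrite mulrA; rewrite -mulr_suml E.
  by rewrite mulNr mulfK // mulrN opprK mulVf.
rewrite -mulN1r; apply: (proper_ideal_mul AI); first exact: (proper_opp AI).
apply: (proper_ideal_mul AI); first by case: (lA i li).
apply: (proper_ideal_sum AI) => h hi; have [->|lh] := eqVneq (l h) 0.
  by rewrite mul0r; apply: (proper_ideal0 AI).
by apply: (proper_ideal_mul AI); [case: (lA h lh) | apply: Ih].
Qed.

Lemma exprz_sum (K : fieldType) (J : Type) (s : seq J) (x : K) (f : J -> int) :
  x != 0 -> \prod_(j <- s) x ^ f j = x ^ (\sum_(j <- s) f j).
Proof.
move=> x0; elim: s => [|j s IH]; first by rewrite !big_nil expr0z.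
by rewrite !big_cons IH expfzDr.
Qed.

(** When the sum of the e_i r_i is 0, the monomial of exponent e in the d_i = c_i x^(r_i) is one in
    c alone. *)
Lemma laurent_twist (K : fieldType) (n N : nat) (c : 'I_N -> K) (x : 'I_n -> K)
    (r : 'I_N -> 'I_n -> int) (e : 'I_N -> int) :
  (forall j, x j != 0) ->
  laurent (fun i => c i * laurent x (r i)) e =
  laurent c e * laurent x (fun j => \sum_i e i * r i j).
Proof.
move=> x0; pose y i := laurent x (r i).
have -> : laurent c e * laurent x (fun j => \sum_i e i * r i j) =
    laurent c e * \prod_i y i ^ e i.
  congr (_ * _); rewrite /laurent.
  under eq_bigr do rewrite -exprz_sum //.
  rewrite exchange_big; apply: eq_bigr => i _ /=.
  rewrite /y /laurent; elim/big_rec2: _ => [|j a b _ ->]; first by rewrite exp1rz.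
  by rewrite expfzMl exprz_exp [e i * _]mulrC.
rewrite /laurent -big_split; apply: eq_bigr => i _ /=.
by rewrite expfzMl.
Qed.

(** For indeterminate y this is the generic vector of L. The rows of [kermx] span L but may be
    dependent. *)
Definition kernel_comb (K : fieldType) (iota : CC -> K) (n m : nat)
    (r : 'I_m.+1 -> 'I_n -> int) (k : nat) (y : 'I_m.+1 -> K) (i : 'I_m.+1) : K :=
  \sum_l y l * iota (kermx (power_mx CC r k) l i).

Lemma kernel_comb_relation (K : fieldType) (iota : {rmorphism CC -> K}) (n m : nat)
    (r : 'I_m.+1 -> 'I_n -> int) (k : nat) (y : 'I_m.+1 -> K) (b : 'I_n -> nat) :
  (\sum_j b j <= k)%N ->
  \sum_i kernel_comb iota r k y i * \prod_j (r i j)%:~R ^+ b j = 0.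
Proof.
move=> bk; rewrite /kernel_comb; under eq_bigr do rewrite mulr_suml.
rewrite exchange_big big1 //= => l _; under eq_bigr do rewrite -mulrA.
rewrite -mulr_sumr.
have /power_mx_relations/(_ b bk) : row l (kermx (power_mx CC r k)) *m power_mx CC r k = 0.
  by rewrite -row_mul mulmx_ker row0.
move=> /(congr1 iota); rewrite rmorph0 rmorph_sum => E.
rewrite (_ : \sum_i _ = 0) ?mulr0 // -[RHS]E; apply: eq_bigr => i _.
rewrite rmorphM /= [row _ _ _ _]mxE rmorph_prod; congr (_ * _); apply: eq_bigr => j _.
by rewrite rmorphXn /= rmorph_int.
Qed.

(* [D] plays the role of the polynomial ring in the indeterminates [X], [Y]:
   they can be specialized to arbitrary complex numbers. *)
Lemma generic_point_ideal (D : idomainType) (kappa : CC -> D)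
    (iota : CC -> {fraction D}) (n m : nat)
    (X : 'I_n -> D) (Y : 'I_m.+1 -> D) (r : 'I_m.+1 -> 'I_n -> int) (k : nat)
    (F : {mpoly CC[m.+1]}) :
  (forall a, iota a = tofrac (kappa a)) ->
  (forall (x : 'I_n -> CC) (y : 'I_m.+1 -> CC), exists e : {rmorphism D -> CC},
    [/\ forall j, e (X j) = x j, forall l, e (Y l) = y l & forall a, e (kappa a) = a]) ->
  mmap iota (fun i => kernel_comb iota r k (fun l => tofrac (Y l)) i *
                      (laurent (fun j => tofrac (X j)) (r i))^-1) F = 0 ->
  ideal_Yk r k F.
Proof.
move=> iotaE univ F0 c [x [x0 /(osc_hyperplaneE _ _ _ x0) osc]].
pose d0 : 'rV[CC]_m.+1 := \row_i (c i * laurent x (r i)).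
have /submxP[y dy] : (d0 <= kermx (power_mx CC r k))%MS.
  apply/sub_kermxP/power_mx_relations => b bk; rewrite -[RHS](osc b bk).
  by apply: eq_bigr => i _; rewrite mxE.
have [e [eX eY eC]] := univ x (y 0).
have sX j : specializes e (tofrac (X j)) (x j).
  by rewrite -eX; apply: specializes_const.
have sC a : specializes e (iota a) a.
  by rewrite -{2}[a]eC iotaE; apply: specializes_const.
have lx0 i : laurent x (r i) != 0 by apply/prodf_neq0 => j _; rewrite expfz_neq0.
rewrite mevalE; apply: (@specializes0 _ _ e); rewrite -F0 /mmap.
apply: specializes_sum => b; apply: specializesM => //.
apply: specializes_prod => i; apply: specializesX.
(* Written as (c_i x^(r_i)) / x^(r_i), the coordinate is visibly the value of the generic one. *)
rewrite -[c i](mulfK (lx0 i)); apply: specializesM; last first.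
  apply: specializesV => //; apply: specializes_prod => j.
  exact: specializes_exprz.
have /rowP/(_ i) := dy; rewrite !mxE => ->; apply: specializes_sum => l.
by apply: specializesM => //; rewrite -eY; apply: specializes_const.
Qed.

(** Deciding the quotients d_j / d_i orders the d_i. Farkas' lemma provides a [w] for which
    [trop_term] respects this order, and minima attained twice for the order become minima attained
    twice for [trop_term]. *)
Lemma intersection_of_generic_point (K : fieldType) (iota : {rmorphism CC -> K})
    (n m : nat) (r : 'I_m.+1 -> 'I_n -> int) (k : nat) (u : 'I_m.+1 -> RR)
    (x : 'I_n -> K) (d : 'I_m.+1 -> K) :
  (forall j, x j != 0) ->
  (forall b : 'I_n -> nat, (\sum_j b j <= k)%N ->
     \sum_i d i * \prod_j (r i j)%:~R ^+ b j = 0) ->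
  (forall F : {mpoly CC[m.+1]},
     mmap iota (fun i => d i * (laurent x (r i))^-1) F = 0 -> ideal_Yk r k F) ->
  trop_Yk r k u ->
  exists w : 'I_n -> RR,
    forall Q : {mpoly rat[n]}, deg_le Q k -> in_V_euler r u Q w.
Proof.
move=> x0 rel gen trop; pose c i := d i * (laurent x (r i))^-1.
have trop' (F : {mpoly CC[m.+1]}) : F != 0 -> mmap iota c F = 0 ->
    ~ is_monomial (initial_form u F).
  by move=> F0 /gen; apply: trop.
have lx0 e : laurent x e != 0 by apply/prodf_neq0 => j _; rewrite expfz_neq0.
have c0 i : c i != 0.
  (* If c_i = 0, the variable 'X_i is in the ideal and is its own initial form. *)
  apply/eqP => ci0; apply: (trop' 'X_i); first by rewrite -msupp_eq0 msuppX.
    by rewrite mmapX mmap1U.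
  apply/is_monomial_initial_form; exists U_(i)%MM; rewrite msuppX ?inE // => a.
  by rewrite inE => ->.
have dE i : d i = c i * laurent x (r i) by rewrite /c mulfVK.
have d0 i : d i != 0 by rewrite dE mulf_neq0.
have AI0 := laurent_span_proper c0 trop'.
have [|A [I [AI [sA sI] dec]]] :=
    decide_seq (s := [seq d p.2 / d p.1 | p : 'I_m.+1 * 'I_m.+1]) AI0.
  by move=> _ /imageP[p _ ->]; rewrite mulf_neq0 ?invr_eq0.
have {}dec i j : decided A I (d j / d i).
  by apply: dec; apply/imageP; exists (i, j).
(* The exponent in x and the u-weight of a Laurent monomial in the d_i lying in [A]; both add up
   under products. *)
pose P (a : 'rV[int]_n) (b : RR) := exists e : 'I_m.+1 -> int,
  [/\ a = \row_j \sum_i e i * r i j, b = eweight u e & A (laurent d e)].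
(* One inequality, [trop_term] at i at most that at j, for each d_j / d_i in [A]. *)
pose S := [seq (\row_j (r p.2 j - r p.1 j), u p.2 - u p.1) |
  p <- [seq p <- enum {: 'I_m.+1 * 'I_m.+1} | `[< A (d p.2 / d p.1) >]]].
have delta (M : zmodType) (f : 'I_m.+1 -> M) i : \sum_h f h *+ (h == i) = f i.
  by rewrite (bigD1 i) //= eqxx big1 ?addr0 // => h /negbTE->.
have [||b|w wS] := @integral_farkas _ n P S.
- move=> a b a' b' [e [-> -> Ae]] [e' [-> -> Ae']].
  exists (fun i => e i + e' i); rewrite eweightD laurentD //; split=> //.
    by apply/rowP => j; rewrite !mxE -big_split; apply: eq_bigr => i _; rewrite mulrDl.
  exact: proper_mul AI _ _ _ _.
- move=> s /mapP[[i j]]; rewrite mem_filter => /andP[/asboolP /= Aij _] -> /=.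
  exists (fun h => (h == j)%:Z - (h == i)%:Z); split.
  + apply/rowP => l; rewrite !mxE.
    under eq_bigr do rewrite mulrBl -!natz !mulr_natl.
    by rewrite sumrB !delta.
  + rewrite /eweight; under eq_bigr do rewrite rmorphB /= mulrBl -!pmulrn !mulr_natl.
    by rewrite sumrB !delta.
  + rewrite laurentD // laurentN.
    have L i' : laurent d (fun h => (h == i')%:Z) = d i'.
      rewrite /laurent (bigD1 i') //= eqxx big1 ?mulr1 // => h /negbTE->.
      by rewrite expr0z.
    by rewrite !L.
(* With x-exponent 0 the monomial d^e equals c^e. Were its weight negative, its inverse would have
   positive weight and lie in [I], and their product 1 would too. *)
- case=> e [a0 -> Ae]; rewrite leNgt; apply/negP => neg.
  have de : laurent d e = laurent c e.
    rewrite (_ : d = fun i => c i * laurent x (r i)); last exact/funext.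
    rewrite laurent_twist // [X in _ * X](_ : _ = 1) ?mulr1 //.
    rewrite /laurent big1 // => j _.
    by have /rowP/(_ j) := a0; rewrite !mxE => <-; rewrite expr0z.
  apply: (proper_proper AI).
  have <- : laurent d e * laurent c (fun i => - e i) = 1.
    by rewrite laurentN de divff //; apply/prodf_neq0 => i _; rewrite expfz_neq0.
  apply: (proper_ideal_mul AI) => //; apply: sI; apply: laurent_span_gen.
  have -> : eweight u (fun i => - e i) = - eweight u e.
    by rewrite /eweight -sumrN; apply: eq_bigr => i _; rewrite rmorphN mulNr.
  by rewrite oppr_gt0.
have le_trop i j : A (d j / d i) -> trop_term r u w i <= trop_term r u w j.
  move=> Aij; have /wS /= : (\row_l (r j l - r i l), u j - u i) \in S.
    by apply/mapP; exists (i, j); rewrite // mem_filter mem_enum andbT; apply/asboolP.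
  under eq_bigr do rewrite mxE rmorphB mulrBr.
  by rewrite sumrB /trop_term; lra.
exists w => Q degQ; pose phi : {rmorphism rat -> _} := iota \o ratr.
have ld0 := evalQ_relation phi degQ rel.
have [Q0|] := EM (forall i, evalQ Q (r i) = 0); first by left.
move=> /existsNP[i0 Qi0]; right.
(* Constants have weight 0, so nonzero rationals are units of [A]. *)
have phi0 q : phi q != 0 -> A (phi q) /\ A (phi q)^-1.
  have Aphi a : A (phi a).
    apply: sA; exists [:: (ratr a, fun=> 0)]; rewrite /= big_seq1 /=.
    rewrite /eweight big1 ?lexx => [|i _]; last by rewrite mul0r.
    by split=> //; rewrite /laurent big1 ?mulr1 // => i _; rewrite expr0z.
  by move=> _; rewrite -fmorphV.
have [||i [j [ij [li lj] Aij Aji imin]]] :=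
    min_attained_twice AI d0 dec _ ld0.
- by move=> i /phi0.
- by exists i0; rewrite fmorph_eq0; apply/eqP.
exists i, j; rewrite -!(fmorph_eq0 phi); split=> //.
  by apply/eqP; rewrite eq_le !le_trop.
by move=> l; rewrite -(fmorph_eq0 phi) => /imin/le_trop.
Qed.

(** The generic point lives over the rational functions in n + (m + 1) variables: the torus
    coordinates and the coefficients of a vector of L. *)
Lemma trop_Yk_intersection (n m : nat) (r : 'I_m.+1 -> 'I_n -> int) (k : nat)
    (u : 'I_m.+1 -> RR) :
  trop_Yk r k u ->
  exists w : 'I_n -> RR,
    forall Q : {mpoly rat[n]}, deg_le Q k -> in_V_euler r u Q w.
Proof.
pose D : idomainType := {mpoly CC[n + m.+1]}.
pose kappa : {rmorphism CC -> D} := @mpolyC (n + m.+1) CC.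
pose tofracD : {rmorphism D -> {fraction D}} := @tofrac D.
pose iota : {rmorphism CC -> {fraction D}} := tofracD \o kappa.
pose X (j : 'I_n) : D := 'X_(lshift m.+1 j).
pose Y (l : 'I_m.+1) : D := 'X_(rshift n l).
apply: (@intersection_of_generic_point _ iota _ _ _ _ _ (fun j => tofrac (X j))
  (kernel_comb iota r k (fun l => tofrac (Y l)))).
- by move=> j; rewrite tofrac_eq0 -msupp_eq0 msuppX.
- exact: kernel_comb_relation.
move=> F; apply: (@generic_point_ideal _ kappa) => // x y.
pose pt s := match split s with inl j => x j | inr l => y l end.
exists (meval pt); split=> [j|l|a].
- by rewrite /X /= mevalXU /pt (unsplitK (inl j)).
- by rewrite /Y /= mevalXU /pt (unsplitK (inr l)).
- by rewrite /= mevalC.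
Qed.

(** * From the intersection to the tropicalization *)

(** [eps] ranges over [K] itself; over the complex numbers, 0 < eps forces it to be real. *)
Definition tends (K : numFieldType) (f : nat -> K) (l : K) : Prop :=
  forall eps, 0 < eps -> exists n0, forall n, (n0 <= n)%N -> `|f n - l| < eps.

Lemma tends_ext (K : numFieldType) (f g : nat -> K) (l : K) :
  (forall n, f n = g n) -> tends f l -> tends g l.
Proof.
by move=> fg fl eps /fl[n0 hn]; exists n0 => n /hn; rewrite fg.
Qed.

Lemma tends_cst (K : numFieldType) (l : K) : tends (fun _ => l) l.
Proof. by move=> eps eps0; exists 0%N => n _; rewrite subrr normr0. Qed.

Lemma tendsD (K : numFieldType) (f g : nat -> K) (l l' : K) :
  tends f l -> tends g l' -> tends (fun n => f n + g n) (l + l').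
Proof.
move=> fl gl eps eps0; have e2 : 0 < eps / 2 by rewrite divr_gt0.
have [[p hp] [q hq]] := (fl _ e2, gl _ e2).
exists (maxn p q) => n; rewrite geq_max => /andP[/hp pn /hq qn].
rewrite opprD addrACA (le_lt_trans (ler_normD _ _)) //.
by rewrite [eps]splitr ltrD.
Qed.

Lemma tendsM (K : numFieldType) (f g : nat -> K) (l l' : K) :
  tends f l -> tends g l' -> tends (fun n => f n * g n) (l * l').
Proof.
move=> fl gl eps eps0.
have L0 : 0 < `|l| + 1 by rewrite ltr_wpDl.
have L'0 : 0 < `|l'| + 1 by rewrite ltr_wpDl.
have e1 : 0 < eps / 2 / (`|l'| + 1) by rewrite !divr_gt0.
have e2 : 0 < eps / 2 / (`|l| + 1) by rewrite !divr_gt0.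
have [[[p hp] [q hq]] [s hs]] := (fl _ e1, gl _ e2, gl _ (@ltr01 K)).
exists (maxn p (maxn q s)) => n; rewrite !geq_max => /and3P[/hp pn /hq qn /hs sn].
have gn : `|g n| <= `|l'| + 1.
  by rewrite -lerBlDl (le_trans (lerB_dist _ _)) // ltW.
have -> : f n * g n - l * l' = (f n - l) * g n + l * (g n - l').
  by rewrite mulrBl mulrBr addrA subrK.
rewrite (le_lt_trans (ler_normD _ _)) // [eps]splitr !normrM ltr_leD //.
  rewrite (le_lt_trans (ler_wpM2l (normr_ge0 _) gn)) //.
  by rewrite -ltr_pdivlMr.
rewrite (le_trans (ler_wpM2l (normr_ge0 _) (ltW qn))) // mulrCA ger_pMr ?divr_gt0 //.
by rewrite ler_pdivrMr // mul1r lerDl.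
Qed.

Lemma tends_sum (K : numFieldType) (J : eqType) (s : seq J) (f : nat -> J -> K)
    (l : J -> K) :
  (forall j, j \in s -> tends (f ^~ j) (l j)) ->
  tends (fun n => \sum_(j <- s) f n j) (\sum_(j <- s) l j).
Proof.
elim: s => [|j s IH] fl.
  by rewrite big_nil; apply: (tends_ext _ (tends_cst 0)) => n; rewrite big_nil.
rewrite big_cons.
apply: (@tends_ext _ (fun n => f n j + \sum_(j <- s) f n j)) => [n|].
  by rewrite big_cons.
apply: tendsD; first by apply: fl; rewrite inE eqxx.
by apply: IH => i si; apply: fl; rewrite inE si orbT.
Qed.

Lemma tends_prod (K : numFieldType) (J : Type) (s : seq J) (f : nat -> J -> K)
    (l : J -> K) :
  (forall j, tends (f ^~ j) (l j)) ->
  tends (fun n => \prod_(j <- s) f n j) (\prod_(j <- s) l j).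
Proof.
move=> fl; elim: s => [|j s IH].
  by rewrite big_nil; apply: (tends_ext _ (tends_cst 1)) => n; rewrite big_nil.
rewrite big_cons.
apply: (@tends_ext _ (fun n => f n j * \prod_(j <- s) f n j)) => [n|].
  by rewrite big_cons.
exact: tendsM.
Qed.

Lemma tendsX (K : numFieldType) (f : nat -> K) (l : K) (a : nat) :
  tends f l -> tends (fun n => f n ^+ a) (l ^+ a).
Proof.
move=> fl; elim: a => [|a IH]; first by rewrite expr0; apply: tends_cst.
rewrite exprS; apply: (@tends_ext _ (fun n => f n * f n ^+ a)) => [n|].
  by rewrite exprS.
exact: tendsM.
Qed.

Lemma tends_cst_eq (K : numFieldType) (a l : K) : tends (fun _ => a) l -> a = l.
Proof.
move=> al; apply/eqP; rewrite -subr_eq0 -normr_eq0; apply/eqP.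
have [//|n0] := eqVneq `|a - l| 0.
have pos : 0 < `|a - l| by rewrite lt_neqAle eq_sym n0 normr_ge0.
by have [p /(_ p (leqnn p))] := al _ pos; rewrite ltxx.
Qed.

(* The complex number [t ^ e], for [t = exp (- N)]. *)
Definition tpow (N : nat) (e : RR) : CC := (Rtrigo_def.exp (- (N%:R * e)))%:C%C.

Lemma tpowD N e f : tpow N (e + f) = tpow N e * tpow N f.
Proof.
by rewrite /tpow -rmorphM mulrDr opprD; congr (real_complex_def _ _); apply: Exp_prop.exp_plus.
Qed.

Lemma tpow0 N : tpow N 0 = 1.
Proof.
by rewrite /tpow mulr0 oppr0 -(rmorph1 (real_complex RR)); congr (real_complex_def _ _); apply: Rtrigo_def.exp_0.
Qed.

Lemma tpow_gt0 N e : 0 < tpow N e.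
Proof. by rewrite /tpow ltcR; apply/RltP; apply: Exp_prop.exp_pos. Qed.

Lemma tpow_neq0 N e : tpow N e != 0.
Proof. by rewrite gt_eqF ?tpow_gt0. Qed.

Lemma tpowN N e : tpow N (- e) = (tpow N e)^-1.
Proof.
by apply: (mulfI (tpow_neq0 N e)); rewrite -tpowD subrr tpow0 mulfV ?tpow_neq0.
Qed.

Lemma tpowMn N e a : tpow N e ^+ a = tpow N (a%:R * e).
Proof.
elim: a => [|a IH]; first by rewrite mul0r tpow0.
by rewrite exprS IH -tpowD mulrS mulrDl mul1r.
Qed.

Lemma tpow_exprz N e (a : int) : tpow N e ^ a = tpow N (e * a%:~R).
Proof.
case: a => a; first by rewrite -exprnP tpowMn mulrC.
by rewrite NegzE -exprnN tpowMn -tpowN rmorphN /= mulrN mulrC.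
Qed.

Lemma tpow_sum N (J : Type) (s : seq J) (e : J -> RR) :
  \prod_(j <- s) tpow N (e j) = tpow N (\sum_(j <- s) e j).
Proof.
elim: s => [|j s IH]; first by rewrite !big_nil tpow0.
by rewrite !big_cons IH tpowD.
Qed.

(** From y < exp y follows y exp(-y) < 1, so exp(-y) < eps once eps y > 1. *)
Lemma tends_tpow e : 0 < e -> tends (tpow ^~ e) 0.
Proof.
move=> e0 eps eps0.
have [eps' [eps'0 ->]] : exists eps' : RR, 0 < eps' /\ eps = eps'%:C%C.
  move: eps0; rewrite ltcE /= => /andP[/eqP I R]; exists (complex.Re eps).
  by split=> //; case: eps I R => a b /= ->.
have [n0 hn0] : exists n0 : nat, (eps' * e)^-1 < n0%:R.
  by exists (Num.bound (eps' * e)^-1); apply: archi_boundP; rewrite invr_ge0 mulr_ge0 // ltW.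
exists n0 => N leN; rewrite subr0 gtr0_norm ?tpow_gt0 // ltcR.
set y := N%:R * e.
have y1 : 1 < eps' * y.
  rewrite /y mulrCA -ltr_pdivrMr ?mulr_gt0 // mul1r (lt_le_trans hn0) //.
  by rewrite ler_nat.
have ey : y < Rtrigo_def.exp y.
  have /RleP := Rpower.exp_ineq1_le y; rewrite (_ : Rdefinitions.RbaseSymbolsImpl.Rplus _ _ = 1 + y) //.
  by apply: lt_le_trans; rewrite ltrDr.
have eyy : Rtrigo_def.exp (- y) * Rtrigo_def.exp y = 1.
  have exp0 : Rtrigo_def.exp (0 : RR) = 1 := Rtrigo_def.exp_0.
  by rewrite -exp0 -(addNr y); symmetry; apply: Exp_prop.exp_plus.
have ey0 : 0 < Rtrigo_def.exp (- y) by apply/RltP; apply: Exp_prop.exp_pos.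
have lt1 : Rtrigo_def.exp (- y) * y < 1 by rewrite -eyy ltr_pM2l.
rewrite (@lt_trans _ _ (Rtrigo_def.exp (- y) * (eps' * y))) //.
  by rewrite ltr_pMr.
by rewrite mulrCA gtr_pMr.
Qed.

Lemma exists_nonroot (p : {poly rat}) : p != 0 -> exists s, p.[s] != 0.
Proof.
move=> p0; pose rs : seq rat := [seq i%:R | i <- iota 0 (size p)].
have [all_root|] := boolP (all (root p) rs); last first.
  by case/allPn => s _ ns; exists s.
suff : uniq rs by move/(max_poly_roots p0 all_root); rewrite size_map size_iota ltnn.
by rewrite map_inj_uniq ?iota_uniq // => i j /eqP; rewrite eqr_nat => /eqP.
Qed.

Lemma power_mx_ratr (K : numFieldType) (n m : nat) (r : 'I_m.+1 -> 'I_n -> int) (k : nat)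
    (z : 'rV[rat]_m.+1) (b : 'I_n -> nat) :
  z *m power_mx rat r k = 0 -> (\sum_j b j <= k)%N ->
  \sum_i ratr (z 0 i) * \prod_j (r i j)%:~R ^+ b j = 0 :> K.
Proof.
move=> /power_mx_relations rel /rel /(congr1 (@ratr K)).
rewrite rmorph0 rmorph_sum => E; rewrite -[RHS]E; apply: eq_bigr => i _.
rewrite rmorphM rmorph_prod; congr (_ * _); apply: eq_bigr => j _.
by rewrite rmorphXn /= ratr_int.
Qed.

(* The rational vectors [Z i], supported where [v] is at most [v i], are combined
   with generic coefficients [s ^ i]. *)
Lemma generic_combination (N : nat) (v : 'I_N -> RR) (Z : 'I_N -> 'rV[rat]_N) :
  (forall i, Z i 0 i != 0) ->
  exists s : rat, forall j, \sum_i (v i == v j)%:R * (s ^+ i * Z i 0 j) != 0.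
Proof.
move=> Z0; pose p j : {poly rat} := \sum_i ((v i == v j)%:R * Z i 0 j) *: 'X^i.
have [|s ps] := @exists_nonroot (\prod_j p j).
  (* The coefficient of degree j in [p j] is the j-th entry of [Z j], which is nonzero. *)
  apply/prodf_neq0 => j _; apply: contra (Z0 j) => /eqP/(congr1 (fun q : {poly rat} => q`_j)).
  rewrite coef0 coef_sum (bigD1 j) //= coefZ coefXn !eqxx mul1r mulr1 big1 ?addr0 => [->//|i ij].
  have /negbTE ji : (j : nat) != i by rewrite eq_sym.
  by rewrite coefZ coefXn ji mulr0.
exists s => j; move: ps; rewrite horner_prod => /prodf_neq0/(_ j isT).
rewrite /p horner_sum; congr (_ != _); apply: eq_bigr => i _.
by rewrite hornerZ hornerXn mulrAC mulrA.
Qed.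

(** On the curve c_j = t^(u_j) h_j, with h_j tending to a nonzero limit as t = exp(-N) tends to 0, a
    polynomial whose initial form has exponent b alone is asymptotic to a nonzero multiple of t to
    the weight of b. It cannot vanish on the whole curve. *)
Lemma intersection_trop_Yk (n m : nat) (r : 'I_m.+1 -> 'I_n -> int) (k : nat)
    (u : 'I_m.+1 -> RR) (w : 'I_n -> RR) :
  (forall Q : {mpoly rat[n]}, deg_le Q k -> in_V_euler r u Q w) -> trop_Yk r k u.
Proof.
move=> V F F0 idF /is_monomial_initial_form[b bF bmin].
pose v := trop_term r u w.
have [Z ZP] := fin_all_exists (euler_initial_vector V).
have [|s sP] := @generic_combination _ v Z; first by move=> i; case: (ZP i).
pose g i j : CC := ratr (s ^+ (i : 'I_m.+1) * Z i 0 j).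
pose x N (j : 'I_n) := tpow N (w j).
(* Terms with v_i < v_j would blow up, but there [g i j] is 0; those with v_i = v_j survive in the
   limit [lead j]. *)
pose h N j := \sum_i g i j * tpow N (v i - v j).
pose c N j := tpow N (u j) * h N j.
pose lead j := \sum_i (v i == v j)%:R * g i j.
have lead0 j : lead j != 0.
  have -> : lead j = ratr (\sum_i (v i == v j)%:R * (s ^+ i * Z i 0 j)).
    rewrite rmorph_sum; apply: eq_bigr => i _.
    by rewrite rmorphM /= rmorph_nat.
  by rewrite fmorph_eq0.
have laurent_x N rho : laurent (x N) rho = tpow N (\sum_j w j * (rho j)%:~R).
  by rewrite -tpow_sum; apply: eq_bigr => j _; rewrite tpow_exprz.
(* The vector (c_j x^(r_j)) is thus a combination of the vectors [Z i] of L. *)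
have cE N j : c N j * laurent (x N) (r j) = \sum_i g i j * tpow N (v i).
  rewrite laurent_x mulrAC -tpowD -/(v j) mulr_sumr; apply: eq_bigr => i _.
  by rewrite mulrCA -tpowD [v j + _]addrC subrK.
have cY N : dual_cone_pt r k (c N).
  have xN0 : torus_pt (x N) by move=> j; apply: tpow_neq0.
  exists (x N); split=> //; apply/osc_hyperplaneE => // a ak.
  under eq_bigr do rewrite cE mulr_suml.
  rewrite exchange_big big1 //= => i _.
  have /power_mx_ratr E : Z i *m power_mx rat r k = 0 by case: (ZP i).
  rewrite -[RHS](mulr0 (ratr (s ^+ i) * tpow N (v i))) -[X in _ = _ * X](E CC a ak) mulr_sumr.
  by apply: eq_bigr => j _; rewrite /g rmorphM /=; ring.
have h_lim j : tends (h ^~ j) (lead j).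
  apply: tends_sum => i _; have [lt_v|gt_v|eq_v] := ltgtP (v i) (v j).
  - have [_ _ /(_ j lt_v) Zij] := ZP i.
    have g0 : g i j = 0 by rewrite /g Zij mulr0 rmorph0.
    by rewrite mul0r; apply: (tends_ext _ (tends_cst 0)) => N; rewrite g0 mul0r.
  - rewrite mul0r -(mulr0 (g i j)); apply: tendsM; first exact: tends_cst.
    by apply: tends_tpow; rewrite subr_gt0.
  - rewrite mul1r; apply: (tends_ext _ (tends_cst (g i j))) => N.
    by rewrite eq_v subrr tpow0 mulr1.
pose lim a : CC := F@_a * ((a == b)%:R * \prod_j lead j ^+ (a : 'X_{1.. m.+1}) j).
have : tends (fun N => F.@[c N] * tpow N (- Defs.mweight u b)) (\sum_(a <- msupp F) lim a).
  have E N : F.@[c N] * tpow N (- Defs.mweight u b) = \sum_(a <- msupp F)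
      F@_a * (tpow N (Defs.mweight u a - Defs.mweight u b) * \prod_j h N j ^+ a j).
    rewrite mevalE mulr_suml; apply: eq_bigr => a _; rewrite tpowD -!mulrA; congr (_ * _).
    rewrite [RHS]mulrCA [LHS]mulrC; congr (_ * _).
    rewrite /Defs.mweight -tpow_sum -big_split; apply: eq_bigr => j _ /=.
    by rewrite exprMn tpowMn.
  apply: (tends_ext (fun N => esym (E N))).
  apply: tends_sum => a aF; apply: tendsM; first exact: tends_cst.
  apply: tendsM; last by apply: tends_prod => j; apply: tendsX.
  have [->|ab] := eqVneq a b.
    by apply: (tends_ext _ (tends_cst 1)) => N; rewrite subrr tpow0.
  by apply: tends_tpow; rewrite subr_gt0 bmin.
rewrite (bigD1_seq b) ?msupp_uniq //= [X in _ + X]big1 => [|a /negbTE ab]; last first.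
  by rewrite /lim ab mul0r mulr0.
rewrite addr0 /lim eqxx mul1r => lim_b.
have : tends (fun _ => 0) (F@_b * \prod_j lead j ^+ b j).
  by apply: (tends_ext _ lim_b) => N; rewrite idF // mul0r.
move/tends_cst_eq/esym/eqP; rewrite mulf_eq0 -[_ == 0]negbK -mcoeff_msupp bF /=.
by apply/negP/prodf_neq0 => j _; rewrite expf_neq0.
Qed.

Theorem theorem5p5 (n m : nat) (r : 'I_m.+1 -> 'I_n -> int) (k : nat) :
  injective r -> lattice_spans r ->
  forall u : 'I_m.+1 -> RR,
    (trop_Yk r k u <->
       exists w : 'I_n -> RR,
         forall Q : {mpoly rat[n]}, deg_le Q k -> in_V_euler r u Q w)
    /\
    (exists Qs : seq {mpoly rat[n]},
       all (fun Q => deg_le Q k) Qs /\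
       forall w : 'I_n -> RR,
         (forall Q, Q \in Qs -> in_V_euler r u Q w) <->
         (forall Q : {mpoly rat[n]}, deg_le Q k -> in_V_euler r u Q w)).
Proof.
move=> _ _ u; split; last exact: finite_euler_family.
split; first exact: trop_Yk_intersection.
by case=> w; apply: intersection_trop_Yk.
Qed.
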